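(* Let $\varepsilon,\delta\in[0,1]$ and let $X=2^\mathbb{N}$ (with the uniform product measure) or $X=[0,1]$ (with Lebesgue measure). Then the following are equivalent: (i) $\mathsf{P}_{>\varepsilon}\mathsf{C}_{X}\le_W\mathsf{P}_{>\delta}\mathsf{C}_{X}$; (ii) $\mathsf{P}_{>\varepsilon}\mathsf{C}_{X}\le_{sW}\mathsf{P}_{>\delta}\mathsf{C}_{X}$; (iii) $\varepsilon\ge\delta$.
   Context: A represented space is a pair $(X,\delta_X)$ with $\delta_X:\subseteq\mathbb{N}^\mathbb{N}\to X$ a partial surjection; $[0,1]$ carries its Cauchy representation. A realizer of $f:\subseteq X\rightrightarrows Y$ is a partial $F$ with $\delta_Y F(p)\in f(\delta_X(p))$ for all $p\in\mathrm{dom}(f\circ\delta_X)$. $f\le_W g$ if there are computable partial $H,K:\subseteq\mathbb{N}^\mathbb{N}\to\mathbb{N}^\mathbb{N}$ such that $p\mapsto H\langle p,GK(p)\rangle$ realizes $f$ for every realizer $G$ of $g$; $f\le_{sW}g$ if instead $HGK$ realizes $f$ for every realizer $G$ of $g$. $\mathcal{A}_-(X)$ denotes the closed subsets of $X$ represented by negative information (a name of $A$ enumerates basic open sets whose union is $X\setminus A$). For a Borel measure $\mu$ on $X$ and $\varepsilon\in\mathbb R$, $\mathsf{P}_{>\varepsilon}\mathsf{C}_X:\subseteq\mathcal{A}_-(X)\rightrightarrows X$, $A\mapsto A$, is defined on all closed $A$ with $\mu(A)>\varepsilon$ (nonempty). The uniform measure on $2^\mathbb N$ satisfies $\mu(w2^\mathbb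 N)=2^{-|w|}$. *)

(* Defs.v *)
From Stdlib Require Import Reals List Arith.
Import ListNotations.
Open Scope R_scope.

Definition baire := nat -> nat.

Definition npair (x y : nat) : nat := ((x + y) * (x + y + 1) / 2 + y)%nat.

Fixpoint lcode (l : list nat) : nat :=
  match l with
  | [] => 0%nat
  | x :: l' => S (npair x (lcode l'))
  end.

Fixpoint prefix (p : baire) (k : nat) : list nat :=
  match k with
  | O => []
  | S k' => prefix p k' ++ [p k']
  end.

Definition bpair (p q : baire) : baire :=
  fun n => if Nat.even n then p (Nat.div2 n) else q (Nat.div2 n).

Inductive PR : Type :=
| PRzero : PR
| PRsucc : PR
| PRproj : nat -> PR
| PRcomp : PR -> list PR -> PR
| PRrec  : PR -> PR -> PR
| PRmu   : PR -> PR.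

Inductive ev : PR -> list nat -> nat -> Prop :=
| ev_zero : forall v, ev PRzero v 0%nat
| ev_succ : forall x v, ev PRsucc (x :: v) (S x)
| ev_proj : forall i v, (i < length v)%nat -> ev (PRproj i) v (nth i v 0%nat)
| ev_comp : forall f gs v ys y, evs gs v ys -> ev f ys y -> ev (PRcomp f gs) v y
| ev_rec0 : forall f g v y, ev f v y -> ev (PRrec f g) (0%nat :: v) y
| ev_recS : forall f g n v r y,
    ev (PRrec f g) (n :: v) r -> ev g (n :: r :: v) y -> ev (PRrec f g) (S n :: v) y
| ev_mu : forall f v n,
    ev f (n :: v) 0%nat ->
    (forall m, (m < n)%nat -> exists k, ev f (m :: v) (S k)) ->
    ev (PRmu f) v n
with evs : list PR -> list nat -> list nat -> Prop :=
| evs_nil : forall v, evs [] v []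
| evs_cons : forall g gs v y ys, ev g v y -> evs gs v ys -> evs (g :: gs) v (y :: ys).

(* A partial F :⊆ N^N -> N^N (modelled as baire -> option baire, domain =
   where it returns Some) is computable iff it has a partial recursive
   associate h: F(p)(n) = h(n, p|k) - 1 for the first k with h(n, p|k) > 0. *)
Definition computable (F : baire -> option baire) : Prop :=
  exists e : PR, forall p q, F p = Some q -> forall n, exists k,
    ev e [n; lcode (prefix p k)] (S (q n)) /\
    forall k', (k' < k)%nat -> ev e [n; lcode (prefix p k')] 0%nat.

Record RepSpace := { carrier :> Type; rep : baire -> carrier -> Prop }.

(* F realizes the multi-valued partial f (dom f = {x | exists y, f x y}) *)
Definition realizes {X Y : RepSpace} (f : X -> Y -> Prop)
  (F : baire -> option baire) : Prop :=
  forall p x, rep X p x -> (exists y, f x y) ->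
    exists q, F p = Some q /\ exists y, rep Y q y /\ f x y.

Definition obind (o : option baire) (k : baire -> option baire) :=
  match o with Some r => k r | None => None end.

Definition weihrauch_le {X1 Y1 X2 Y2 : RepSpace}
  (f : X1 -> Y1 -> Prop) (g : X2 -> Y2 -> Prop) : Prop :=
  exists H K, computable H /\ computable K /\
    forall G, realizes g G ->
      realizes f (fun p => obind (K p) (fun r => obind (G r) (fun s => H (bpair p s)))).

Definition strong_weihrauch_le {X1 Y1 X2 Y2 : RepSpace}
  (f : X1 -> Y1 -> Prop) (g : X2 -> Y2 -> Prop) : Prop :=
  exists H K, computable H /\ computable K /\
    forall G, realizes g G ->
      realizes f (fun p => obind (K p) (fun r => obind (G r) H)).

Fixpoint psum (f : nat -> R) (N : nat) : R :=
  match N with O => 0 | S n => psum f n + f n end.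

Definition is_glb (S : R -> Prop) (m : R) : Prop :=
  (forall r, S r -> m <= r) /\ (forall l, (forall r, S r -> l <= r) -> l <= m).

Definition zint (n : nat) : R :=
  if Nat.even n then INR (Nat.div2 n) else - INR (Nat.div2 (S n)).

Definition ratv (z d : nat) : R := zint z / INR (S d).

Definition cantor := nat -> bool.

Definition Cantor : RepSpace :=
  {| carrier := cantor;
     rep := fun p x => forall n, (p n <= 1)%nat /\ (x n = true <-> p n = 1%nat) |}.

Definition bprefix (w : list bool) (x : cantor) : Prop :=
  forall i, (i < length w)%nat -> nth i w false = x i.

(* a name of a closed A enumerates (codes + 1 of) words w, 0 meaning "nothing";
   the union of the cylinders w2^N is the complement of A *)
Definition cantor_closed_name (p : baire) (A : cantor -> Prop) : Prop :=
  forall x, ~ A x <->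
    exists n w, p n = S (lcode (map (fun b : bool => if b then 1%nat else 0%nat) w))
                /\ bprefix w x.

Definition CantorClosed : RepSpace :=
  {| carrier := cantor -> Prop; rep := cantor_closed_name |}.

(* uniform measure (outer measure built from mu(w2^N) = 2^-|w|) *)
Definition cantor_measure (A : cantor -> Prop) (m : R) : Prop :=
  is_glb (fun r => exists c : nat -> list bool,
            (forall x, A x -> exists i, bprefix (c i) x) /\
            forall N, psum (fun i => (/2) ^ length (c i)) N <= r) m.

Definition PC_cantor (eps : R) : CantorClosed -> Cantor -> Prop :=
  fun A x => (exists m, cantor_measure A m /\ eps < m) /\ A x.

Definition Unit : RepSpace :=
  {| carrier := R;
     rep := fun p x => 0 <= x <= 1 /\ forall n, exists z d,
              p n = lcode [z; d] /\ Rabs (x - ratv z d) <= (/2) ^ n |}.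

(* negative information: enumeration of rational open intervals (a,b)
   (relative to [0,1]) whose union is [0,1] \ A *)
Definition unit_closed_name (p : baire) (A : R -> Prop) : Prop :=
  (forall x, A x -> 0 <= x <= 1) /\
  forall x, 0 <= x <= 1 ->
    (~ A x <-> exists n z1 d1 z2 d2, p n = S (lcode [z1; d1; z2; d2]) /\
                 ratv z1 d1 < x < ratv z2 d2).

Definition UnitClosed : RepSpace :=
  {| carrier := R -> Prop; rep := unit_closed_name |}.

Definition lebesgue_measure (A : R -> Prop) (m : R) : Prop :=
  is_glb (fun r => exists a b : nat -> R,
            (forall i, a i <= b i) /\
            (forall x, A x -> exists i, a i < x < b i) /\
            forall N, psum (fun i => b i - a i) N <= r) m.

Definition PC_unit (eps : R) : UnitClosed -> Unit -> Prop :=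
  fun A x => (exists m, lebesgue_measure A m /\ eps < m) /\ A x.

(* Main.v *)
(* A word of length [n] or a dyadic cell of length [2^-n] serves as a label of points.
   Suppose [eps < k / 2^n < delta] and consider the empty name of the full space.
   By compactness, finitely many bits of a point of the set named by [K] determine
   the label of the answer computed by [H], and the same bits work for every name
   with a long enough common prefix with the empty name. Assign to each label the measure
   of the points whose answer carries it; these masses add up to at most 1, so some
   set [S] of [k] labels has mass at most [k / 2^n]. Now continue the empty name to a name
   of the closed set [A] of points with labels in [S], of measure greater than [eps]: all
   points of the set named by [K] must be sent into [A], hence this set has measure at
   most [k / 2^n < delta], which is absurd. Only continuity of [H] and [K] is used. The
   converse is witnessed by the identity. *)
Require Import Defs.
From Stdlib Require Import Reals List Arith ZArith Bool Lia Lra.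
From Stdlib Require Import Classical ClassicalEpsilon FunctionalExtensionality PropExtensionality.
Import ListNotations.
Open Scope R_scope.

(** * Recursive functions *)

(** Both inequalities around k / 2^n are spent. The gap below [delta] gives the contradiction. The
    gap above [eps] is needed on the interval: no continuous map decides on which side of a cell
    boundary a real lies, so there A has to keep a distance from all boundaries and loses some
    measure. For the same reason labels belong to names, not to points, and may be missing. Masses
    are counted, not integrated. A label is a function of words of length L, so its mass is a number
    of words over 2^L, and the (outer) measures enter only through upper bounds from finite covers
    and lower bounds for complements of finite covers. One name is fixed for each bit sequence, so
    that the answer is a function of the bits; a real with two expansions may receive two labels
    without harm. The set S is known only once L is, which is why A must be nameable after an
    arbitrarily long silent start. *)

(** The fixpoint is written by hand because [ev_mu] hides derivations under [exists] and [ev_comp]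
    refers to [evs]; plain induction gives no hypothesis for either. *)
Lemma ev_deterministic : forall e v y, ev e v y -> forall y', ev e v y' -> y = y'.
Proof.
  fix IH 4 with (IHs gs v ys (Hs : evs gs v ys) {struct Hs} :
    forall ys', evs gs v ys' -> ys = ys').
  - intros e v y [v0|x v0|i v0 Hi|f gs v0 ys y0 Hgs Hf|f g v0 y0 Hf|f g n v0 r y0 Hr Hg
                 |f v0 n H0 Hlt] y' H.
    + inversion H; auto.
    + inversion H; auto.
    + inversion H; auto.
    + inversion H as [| | |f1 gs1 v1 ys1 y1 Hgs1 Hf1 E1 E2 E3| | |]; subst.
      rewrite <- (IHs _ _ _ Hgs _ Hgs1) in Hf1; exact (IH _ _ _ Hf _ Hf1).
    + inversion H as [| | | |f1 g1 v1 y1 Hf1 E1 E2 E3| |]; subst; exact (IH _ _ _ Hf _ Hf1).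
    + inversion H as [| | | | |f1 g1 n1 v1 r1 y1 Hr1 Hg1 E1 E2 E3|]; subst.
      rewrite <- (IH _ _ _ Hr _ Hr1) in Hg1; exact (IH _ _ _ Hg _ Hg1).
    + inversion H as [| | | | | |f1 v1 n1 H1 Hlt1 E1 E2 E3]; subst.
      destruct (lt_eq_lt_dec n y') as [[Hn|Hn]|Hn]; auto.
      * destruct (Hlt1 n Hn) as [k Hk]; discriminate (IH _ _ _ H0 _ Hk).
      * destruct (Hlt y' Hn) as [k Hk]; discriminate (IH _ _ _ Hk _ H1).
  - intros gs v ys [v0|g gs0 v0 y ys0 Hg Hgs] ys' H.
    + inversion H; auto.
    + inversion H as [|g1 gs1 v1 y1 ys1 Hg1 Hgs1 E1 E2 E3]; subst.
      f_equal; [exact (IH _ _ _ Hg _ Hg1) | exact (IHs _ _ _ Hgs _ Hgs1)].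
Qed.

Definition computes1 (e : PR) (f : nat -> nat) := forall x v, ev e (x :: v) (f x).
Definition computes2 (e : PR) (f : nat -> nat -> nat) :=
  forall x y v, ev e (x :: y :: v) (f x y).

Lemma ev_comp1 f g v y z : ev g v y -> ev f [y] z -> ev (PRcomp f [g]) v z.
Proof. intros; econstructor; eauto; repeat econstructor; auto. Qed.

Lemma ev_comp2 f g g' v y y' z :
  ev g v y -> ev g' v y' -> ev f [y; y'] z -> ev (PRcomp f [g; g']) v z.
Proof. intros; econstructor; [|eauto]; repeat (econstructor; eauto). Qed.

Lemma ev_proj0 x v : ev (PRproj 0) (x :: v) x.
Proof. apply (ev_proj 0 (x :: v)); simpl; lia. Qed.

Lemma ev_proj1 x y v : ev (PRproj 1) (x :: y :: v) y.
Proof. apply (ev_proj 1 (x :: y :: v)); simpl; lia. Qed.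

Lemma ev_proj2 x y z v : ev (PRproj 2) (x :: y :: z :: v) z.
Proof. apply (ev_proj 2 (x :: y :: z :: v)); simpl; lia. Qed.

Local Ltac evt := eauto using ev_comp1, ev_comp2, ev_proj0, ev_proj1, ev_proj2, ev_zero, ev_succ.

Definition pr_pred := PRrec PRzero (PRproj 0).
Definition pr_add := PRrec (PRproj 0) (PRcomp PRsucc [PRproj 1]).
(** The arguments are swapped because [PRrec] recurses on the first one. *)
Definition pr_rsub := PRrec (PRproj 0) (PRcomp pr_pred [PRproj 1]).
(** A recursion that ignores its accumulator: the step sees predecessor, accumulator, [b], [c] in
    this order, hence index 3. *)
Definition pr_if0 (a b c : PR) :=
  PRcomp (PRrec (PRproj 0) (PRproj 3)) [a; b; c].
Definition pr_tri := PRrec PRzero (PRcomp PRsucc [PRcomp pr_add [PRproj 0; PRproj 1]]).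

(** Triangular numbers, which turn the division in [npair] into a recursion. *)
Fixpoint tri (n : nat) : nat := match n with O => O | S m => S (m + tri m) end.

Lemma pr_pred_ok : computes1 pr_pred pred.
Proof.
  intros [|x] v; [apply ev_rec0; evt|].
  apply ev_recS with (r := pred x); [|evt].
  induction x; [apply ev_rec0; evt | apply ev_recS with (r := pred x); evt].
Qed.

Lemma pr_add_ok : computes2 pr_add Nat.add.
Proof. intros x y v; induction x; [apply ev_rec0 | eapply ev_recS; [eassumption|]]; evt. Qed.

Lemma pr_rsub_ok : computes2 pr_rsub (fun x y => y - x)%nat.
Proof.
  intros x y v; induction x.
  - rewrite Nat.sub_0_r; apply ev_rec0; evt.
  - eapply ev_recS; [eassumption|].
    replace (y - S x)%nat with (pred (y - x)) by lia.
    eapply ev_comp1; [evt | apply pr_pred_ok].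
Qed.

Lemma pr_if0_ok a b c v x y z : ev a v x -> ev b v y -> ev c v z ->
  ev (pr_if0 a b c) v (match x with O => y | S _ => z end).
Proof.
  intros Ha Hb Hc.
  apply ev_comp with (ys := [x; y; z]); [repeat (constructor; auto)|].
  destruct x as [|x]; [apply ev_rec0; evt|].
  assert (Hr : exists r, ev (PRrec (PRproj 0) (PRproj 3)) (x :: [y; z]) r).
  { clear Ha; induction x as [|x [r Hr]]; [exists y; apply ev_rec0; evt|].
    exists z; eapply ev_recS; [exact Hr|]; apply (ev_proj 3 [x; r; y; z]); simpl; lia. }
  destruct Hr as [r Hr]; eapply ev_recS; [eassumption|].
  apply (ev_proj 3 [x; r; y; z]); simpl; lia.
Qed.

Lemma pr_tri_ok : computes1 pr_tri tri.
Proof.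
  intros x v; induction x; [apply ev_rec0; evt|].
  eapply ev_recS; [eassumption|].
  eapply ev_comp1; [|apply ev_succ].
  eapply ev_comp2; [evt | evt | apply pr_add_ok].
Qed.

Lemma tri_double n : (2 * tri n = n * (n + 1))%nat.
Proof. induction n; simpl tri; lia. Qed.

Lemma npair_tri x y : npair x y = (tri (x + y) + y)%nat.
Proof.
  unfold npair; rewrite <- tri_double, Nat.mul_comm, Nat.div_mul; auto.
Qed.

(* [diag m] is the largest [s] with [tri s <= m], i.e. [x + y] for [m = npair x y]. *)
Fixpoint diag (m : nat) : nat :=
  match m with
  | O => O
  | S m' => match (tri (S (diag m')) - S m')%nat with O => S (diag m') | S _ => diag m' end
  end.

Lemma diag_spec m : (tri (diag m) <= m < tri (S (diag m)))%nat.
Proof.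
  induction m as [|m IH]; [simpl; lia|].
  cbn [diag]; destruct (tri (S (diag m)) - S m)%nat eqn:E; [|lia].
  split; [lia|].
  change (tri (S (S (diag m)))) with (S (S (diag m) + tri (S (diag m)))); lia.
Qed.

Lemma tri_mono a b : (a <= b -> tri a <= tri b)%nat.
Proof. induction 1; simpl; lia. Qed.

Lemma diag_unique m s : (tri s <= m < tri (S s))%nat -> diag m = s.
Proof.
  intros Hs; pose proof (diag_spec m) as Hm.
  destruct (lt_eq_lt_dec (diag m) s) as [[H|H]|H]; auto; apply tri_mono in H; lia.
Qed.

Definition usnd m := (m - tri (diag m))%nat.
Definition ufst m := (diag m - usnd m)%nat.

Lemma diag_npair x y : diag (npair x y) = (x + y)%nat.
Proof. apply diag_unique; rewrite npair_tri; simpl; lia. Qed.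

Lemma usnd_npair x y : usnd (npair x y) = y.
Proof. unfold usnd; rewrite diag_npair, npair_tri; lia. Qed.

Lemma ufst_npair x y : ufst (npair x y) = x.
Proof. unfold ufst; rewrite usnd_npair, diag_npair; lia. Qed.

Lemma lcode_inj l l' : lcode l = lcode l' -> l = l'.
Proof.
  revert l'; induction l as [|x l IH]; intros [|x' l']; cbn [lcode]; try discriminate; auto.
  intros E; injection E as E.
  pose proof (f_equal ufst E) as E1; pose proof (f_equal usnd E) as E2.
  rewrite !ufst_npair in E1; rewrite !usnd_npair in E2.
  f_equal; auto.
Qed.

Definition pr_diag := PRrec PRzero
  (pr_if0 (PRcomp pr_rsub [PRcomp PRsucc [PRproj 0]; PRcomp pr_tri [PRcomp PRsucc [PRproj 1]]])
     (PRcomp PRsucc [PRproj 1]) (PRproj 1)).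
Definition pr_usnd := PRcomp pr_rsub [PRcomp pr_tri [pr_diag]; PRproj 0].
Definition pr_ufst := PRcomp pr_rsub [pr_usnd; pr_diag].

Lemma pr_diag_ok : computes1 pr_diag diag.
Proof.
  intros x v; induction x; [apply ev_rec0; evt|].
  eapply ev_recS; [eassumption|].
  apply (pr_if0_ok _ _ _ _ (tri (S (diag x)) - S x) (S (diag x)) (diag x)); evt.
  eapply ev_comp2; [evt | | apply pr_rsub_ok].
  eapply ev_comp1; [evt | apply pr_tri_ok].
Qed.

Lemma pr_usnd_ok : computes1 pr_usnd usnd.
Proof.
  intros x v; eapply ev_comp2; [| evt | apply pr_rsub_ok].
  eapply ev_comp1; [apply pr_diag_ok | apply pr_tri_ok].
Qed.

Lemma pr_ufst_ok : computes1 pr_ufst ufst.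
Proof.
  intros x v; eapply ev_comp2; [apply pr_usnd_ok | apply pr_diag_ok | apply pr_rsub_ok].
Qed.

Definition ctail c := match c with O => O | S m => usnd m end.
Definition pr_ctail := pr_if0 (PRproj 0) PRzero (PRcomp pr_usnd [PRcomp pr_pred [PRproj 0]]).

Lemma pr_ctail_ok : computes1 pr_ctail ctail.
Proof.
  intros x v.
  replace (ctail x) with (match x with O => O | S _ => usnd (pred x) end) by (destruct x; auto).
  apply pr_if0_ok; evt.
  eapply ev_comp1; [eapply ev_comp1; [evt | apply pr_pred_ok] | apply pr_usnd_ok].
Qed.

Fixpoint cdrop (n c : nat) : nat := match n with O => c | S m => ctail (cdrop m c) end.
(** The offset is that of an associate: 0 while the prefix is too short, otherwise one more than the
    entry. *)
Definition cnth n c := match cdrop n c with O => O | S m => S (ufst m) end.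

Definition pr_cdrop := PRrec (PRproj 0) (PRcomp pr_ctail [PRproj 1]).
Definition pr_cnth :=
  pr_if0 pr_cdrop PRzero (PRcomp PRsucc [PRcomp pr_ufst [PRcomp pr_pred [pr_cdrop]]]).

Lemma pr_cdrop_ok : computes2 pr_cdrop cdrop.
Proof.
  intros x y v; induction x; [apply ev_rec0; evt|].
  eapply ev_recS; [eassumption|].
  eapply ev_comp1; [evt | apply pr_ctail_ok].
Qed.

Lemma pr_cnth_ok : computes2 pr_cnth cnth.
Proof.
  intros x y v.
  replace (cnth x y) with
    (match cdrop x y with O => O | S _ => S (ufst (pred (cdrop x y))) end)
    by (unfold cnth; destruct (cdrop x y); auto).
  apply pr_if0_ok; [apply pr_cdrop_ok | evt |].
  eapply ev_comp1; [|apply ev_succ].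
  eapply ev_comp1; [|apply pr_ufst_ok].
  eapply ev_comp1; [apply pr_cdrop_ok | apply pr_pred_ok].
Qed.

Lemma cdrop_lcode n l : cdrop n (lcode l) = lcode (skipn n l).
Proof.
  assert (Ht : forall l, ctail (lcode l) = lcode (tl l)).
  { intros [|x l']; auto; cbn [lcode ctail tl]; apply usnd_npair. }
  revert l; induction n; intros l; auto.
  cbn [cdrop]; rewrite IHn, Ht; f_equal.
  clear IHn; revert l; induction n; intros [|x l]; auto.
  rewrite skipn_cons, IHn; auto.
Qed.

Lemma cnth_lcode n l :
  cnth n (lcode l) = match nth_error l n with Some x => S x | None => O end.
Proof.
  unfold cnth; rewrite cdrop_lcode.
  revert l; induction n; intros [|x l]; auto.
  - cbn [skipn lcode nth_error]; rewrite ufst_npair; auto.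
  - cbn [skipn nth_error]; apply IHn.
Qed.

(** * Re-indexing maps and the reduction by the identity *)

Lemma prefix_length p k : length (prefix p k) = k.
Proof. induction k; simpl; auto; rewrite length_app, IHk; simpl; lia. Qed.

Lemma prefix_nth_error p k n : (n < k)%nat -> nth_error (prefix p k) n = Some (p n).
Proof.
  induction k; [lia|]; intros Hn; cbn [prefix].
  destruct (Nat.eq_dec n k) as [->|Hk].
  - rewrite nth_error_app2; rewrite prefix_length; auto.
    rewrite Nat.sub_diag; auto.
  - rewrite nth_error_app1; [apply IHk; lia | rewrite prefix_length; lia].
Qed.

(** Entry [f n] is visible exactly in the prefixes longer than [f n], so looking it up with [cnth]
    is already an associate, and it first answers at length [S (f n)]. *)
Lemma reindex_computable e f : computes1 e f ->
  computable (fun p => Some (fun n => p (f n))).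
Proof.
  intros He; exists (PRcomp pr_cnth [PRcomp e [PRproj 0]; PRproj 1]).
  intros p q E; injection E as <-; intros n; exists (S (f n)).
  assert (Hev : forall k,
    ev (PRcomp pr_cnth [PRcomp e [PRproj 0]; PRproj 1]) [n; lcode (prefix p k)]
       (cnth (f n) (lcode (prefix p k)))).
  { intros k; eapply ev_comp2; [eapply ev_comp1; [evt | apply He] | evt | apply pr_cnth_ok]. }
  split.
  - specialize (Hev (S (f n))).
    rewrite cnth_lcode, prefix_nth_error in Hev; auto.
  - intros k Hk; specialize (Hev k).
    rewrite cnth_lcode in Hev.
    destruct (nth_error (prefix p k) (f n)) eqn:En; auto.
    assert (Hl : (f n < length (prefix p k))%nat) by (apply nth_error_Some; congruence).
    rewrite prefix_length in Hl; lia.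
Qed.

Lemma id_computable : computable (fun p => Some p).
Proof.
  apply (reindex_computable (PRproj 0) (fun n => n)); intros x v; evt.
Qed.

(** This map recovers [s] from [bpair p s]; it is the outer function of the ordinary reduction. *)
Lemma odd_part_computable : computable (fun p => Some (fun n => p (S (n + n)))).
Proof.
  apply (reindex_computable (PRcomp PRsucc [PRcomp pr_add [PRproj 0; PRproj 0]])
           (fun n => S (n + n))).
  intros x v; eapply ev_comp1; [eapply ev_comp2; [evt | evt | apply pr_add_ok] | evt].
Qed.

Lemma bpair_odd p q n : bpair p q (S (n + n)) = q n.
Proof.
  unfold bpair; replace (S (n + n)) with (S (2 * n)) by lia.
  rewrite Nat.even_succ, Nat.div2_succ_double.
  rewrite <- Nat.negb_even, Nat.even_even; auto.
Qed.

(** The hypotheses make [f] the restriction of [g] to a smaller domain, so every realizer of [g]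
    realizes [f]. *)
Lemma reducible_of_subset (X Y : RepSpace) (f g : X -> Y -> Prop) :
  (forall x y, f x y -> g x y) ->
  (forall x y, (exists y', f x y') -> g x y -> f x y) ->
  weihrauch_le f g /\ strong_weihrauch_le f g.
Proof.
  intros Hfg Hgf.
  assert (HG : forall G, realizes g G -> realizes f G).
  { intros G HG p x Hp Hx.
    destruct (HG p x Hp) as [q [Hq [y [Hy Hg]]]].
    { destruct Hx as [y Hy]; eauto. }
    exists q; split; auto; exists y; auto. }
  split.
  - exists (fun p => Some (fun n => p (S (n + n)))), (fun p => Some p).
    split; [apply odd_part_computable | split; [apply id_computable|]].
    intros G HG' p x Hp Hx; destruct (HG G HG' p x Hp Hx) as [q [Hq Hy]].
    exists q; split; auto; simpl; rewrite Hq; simpl; f_equal.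
    apply functional_extensionality; intros n; apply bpair_odd.
  - exists (fun p => Some p), (fun p => Some p).
    split; [apply id_computable | split; [apply id_computable|]].
    intros G HG' p x Hp Hx; destruct (HG G HG' p x Hp Hx) as [q [Hq Hy]].
    exists q; split; auto; simpl; rewrite Hq; auto.
Qed.

(** * Continuity *)

Definition agree {T : Type} (k : nat) (p q : nat -> T) := forall i, (i < k)%nat -> p i = q i.

Lemma agree_le {T : Type} k k' (p q : nat -> T) : (k <= k')%nat -> agree k' p q -> agree k p q.
Proof. intros Hk H i Hi; apply H; lia. Qed.

Lemma agree_sym {T : Type} k (p q : nat -> T) : agree k p q -> agree k q p.
Proof. intros H i Hi; symmetry; auto. Qed.

Lemma prefix_agree k p q : agree k p q -> prefix p k = prefix q k.
Proof.
  induction k; auto; intros H; simpl; rewrite IHk, (H k); auto.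
  apply agree_le with (2 := H); auto.
Qed.

Definition continuous (F : baire -> option baire) := forall p q M, F p = Some q ->
  exists k, forall p' q', F p' = Some q' -> agree k p p' -> agree M q q'.

(** The first stage at which the associate answers on [p] reads a finite prefix. An input sharing it
    gets the same replies up to that stage, so by determinism it answers at the same stage with the
    same value. *)
Lemma computable_continuous F : computable F -> continuous F.
Proof.
  intros [e He] p q M Hq; induction M as [|M [k Hk]].
  { exists 0%nat; intros p' q' _ _ i Hi; lia. }
  destruct (He p q Hq M) as [k1 [Hk1 Hlt]].
  exists (max k k1); intros p' q' Hq' Ha i Hi.
  destruct (Nat.eq_dec i M) as [->|HiM].
  2:{ apply (Hk p' q' Hq'); [apply agree_le with (2 := Ha)|]; lia. }
  assert (Hpre : forall j, (j <= k1)%nat -> prefix p' j = prefix p j).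
  { intros j Hj; symmetry; apply prefix_agree, agree_le with (2 := Ha); lia. }
  destruct (He p' q' Hq' M) as [k2 [Hk2 Hlt2]].
  destruct (lt_eq_lt_dec k1 k2) as [[H|H]|H].
  - specialize (Hlt2 k1 H); rewrite Hpre in Hlt2 by auto.
    discriminate (ev_deterministic _ _ _ Hk1 _ Hlt2).
  - subst k2; rewrite Hpre in Hk2 by auto.
    injection (ev_deterministic _ _ _ Hk1 _ Hk2); auto.
  - rewrite Hpre in Hk2 by lia.
    discriminate (ev_deterministic _ _ _ Hk2 _ (Hlt k2 H)).
Qed.

(** * Binary words *)

Fixpoint words (L : nat) : list (list bool) :=
  match L with
  | O => [[]]
  | S L' => map (cons true) (words L') ++ map (cons false) (words L')
  end.

Lemma in_words L w : In w (words L) <-> length w = L.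
Proof.
  revert w; induction L; intros w; simpl.
  - destruct w; simpl; split; intros H; auto; try discriminate.
    destruct H as [H|[]]; discriminate.
  - rewrite in_app_iff, !in_map_iff; split.
    + intros [[v [<- Hv]]|[v [<- Hv]]]; simpl; f_equal; apply IHL; auto.
    + destruct w as [|[] w]; intros H; try discriminate; injection H as H;
        [left | right]; exists w; split; auto; apply IHL; auto.
Qed.

Lemma words_length L : length (words L) = (2 ^ L)%nat.
Proof. induction L; simpl; auto; rewrite length_app, !length_map; lia. Qed.

Definition restrict (b : cantor) (k : nat) : list bool := map b (seq 0 k).

Lemma restrict_length b k : length (restrict b k) = k.
Proof. unfold restrict; rewrite length_map, length_seq; auto. Qed.

Lemma restrict_nth b k i : (i < k)%nat -> nth i (restrict b k) false = b i.
Proof.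
  intros Hi; unfold restrict; rewrite nth_indep with (d' := b 0%nat).
  - rewrite map_nth, seq_nth; auto.
  - rewrite length_map, length_seq; auto.
Qed.

Lemma bprefix_restrict b k : bprefix (restrict b k) b.
Proof. intros i; rewrite restrict_length; apply restrict_nth. Qed.

(** König's argument: a word is bad if no depth is uniform below it. Badness passes to a child, so a
    failure at the root yields an infinite path of bad words, which cannot meet [P]. *)
Lemma fan (P : list bool -> Prop) :
  (forall w v, P w -> P (w ++ v)) -> (forall b, exists k, P (restrict b k)) ->
  exists L, forall w, length w = L -> P w.
Proof.
  intros Hmono Hbar; apply NNPP; intros Hno.
  set (bad := fun w => forall L, exists v, length v = L /\ ~ P (w ++ v)).
  assert (Hstep : forall w, bad w -> bad (w ++ [true]) \/ bad (w ++ [false])).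
  { intros w Hw; apply NNPP; intros Hc; apply not_or_and in Hc as [Ht Hf].
    apply not_all_ex_not in Ht as [Lt Ht]; apply not_all_ex_not in Hf as [Lf Hf].
    (* The first bit of this counterexample selects the child; the rest is long enough to be cut to
       the child's bound, and by [Hmono] the cut word still fails [P]. *)
    destruct (Hw (S (max Lt Lf))) as [[|x v] [Hv HP]]; [discriminate|].
    injection Hv as Hv.
    assert (Hcut : forall L, (L <= length v)%nat ->
              ~ (exists v', length v' = L /\ ~ P ((w ++ [x]) ++ v')) -> False).
    { intros L HL Hn; apply Hn; exists (firstn L v); split.
      - rewrite length_firstn; lia.
      - intros HP'; apply HP; apply Hmono with (v := skipn L v) in HP'.
        rewrite <- !app_assoc, firstn_skipn in HP'; auto. }
    destruct x; [apply (Hcut Lt) | apply (Hcut Lf)]; auto; lia. }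
  set (next := fun w => if excluded_middle_informative (bad (w ++ [true])) then true else false).
  set (node := fix node n :=
         match n with O => [] | S m => node m ++ [next (node m)] end).
  assert (Hnode : forall n, bad (node n)).
  { induction n; cbn [node].
    - intros L; apply NNPP; intros Hc; apply Hno; exists L; intros w Hw.
      apply NNPP; intros HP; apply Hc; exists w; auto.
    - unfold next; destruct (excluded_middle_informative _); auto.
      destruct (Hstep _ IHn); auto; contradiction. }
  destruct (Hbar (fun n => next (node n))) as [k Hk].
  assert (E : forall n, restrict (fun n => next (node n)) n = node n).
  { induction n; auto; unfold restrict in *; rewrite seq_S, map_app, IHn; auto. }
  rewrite E in Hk; destruct (Hnode k 0%nat) as [[|] [Hv HP]]; [|discriminate].
  rewrite app_nil_r in HP; auto.
Qed.

(** * Averaging over labels *)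

Lemma heavy_element (c : nat -> nat) l : l <> [] ->
  exists x, In x l /\ (list_sum (map c l) <= length l * c x)%nat.
Proof.
  induction l as [|y l IH]; [congruence|]; intros _.
  destruct l as [|z l]; [exists y; simpl; lia|].
  destruct IH as [x [Hx Hs]]; [discriminate|].
  set (l' := z :: l) in *; change (map c (y :: l')) with (c y :: map c l').
  cbn [list_sum fold_right length]; fold (list_sum (map c l')).
  destruct (le_lt_dec (c x) (c y)).
  - exists y; split; [left; auto | nia].
  - exists x; split; [right; auto | nia].
Qed.

(* Discarding a heaviest element never increases the average weight. *)
Lemma light_subset (c : nat -> nat) k l : NoDup l -> (k <= length l)%nat ->
  exists s, NoDup s /\ incl s l /\ length s = k /\
    (length l * list_sum (map c s) <= k * list_sum (map c l))%nat.
Proof.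
  remember (length l - k)%nat as d eqn:Hd; revert l Hd.
  induction d as [|d IH]; intros l Hd Hl Hk.
  { exists l; repeat split; auto using incl_refl; try lia.
    replace (length l) with k by lia; auto. }
  destruct (heavy_element c l) as [x [Hx Hs]]; [destruct l; simpl in *; [lia|discriminate]|].
  destruct (in_split _ _ Hx) as [l1 [l2 ->]].
  pose proof (NoDup_remove_1 _ _ _ Hl) as Hl'.
  rewrite length_app in *; cbn [length] in *.
  destruct (IH (l1 ++ l2)) as [s [Hs1 [Hs2 [Hs3 Hs4]]]]; auto;
    rewrite ?length_app in *; try lia.
  exists s; repeat split; auto.
  { intros y Hy; apply Hs2 in Hy; rewrite in_app_iff in *; simpl; tauto. }
  rewrite map_app, list_sum_app in *; cbn [map list_sum fold_right] in *.
  fold (list_sum (map c l2)) in *.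
  (* For [k = 0] nothing is left to show; otherwise [m] is positive and can be cancelled after
     multiplying the goal by it. *)
  destruct s as [|y s]; [simpl; lia|]; cbn [length] in Hs3.
  set (m := (length l1 + length l2)%nat) in *.
  replace (length l1 + S (length l2))%nat with (S m) in * by lia.
  set (t := list_sum (map c (y :: s))) in *.
  set (a := list_sum (map c l1)) in *; set (b := list_sum (map c l2)) in *.
  assert (Hm : (S m * (a + b) <= m * (a + (c x + b)))%nat) by nia.
  apply Nat.mul_le_mono_pos_l with (p := m); [lia|].
  assert (S m * (m * t) <= S m * (k * (a + b)))%nat by (apply Nat.mul_le_mono_l; auto).
  assert (k * (S m * (a + b)) <= k * (m * (a + (c x + b))))%nat by (apply Nat.mul_le_mono_l; auto).
  lia.
Qed.

Definition labelled {A} (lab : A -> nat) (s : list nat) (u : A) := existsb (Nat.eqb (lab u)) s.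

Lemma labelled_iff {A} (lab : A -> nat) s u : labelled lab s u = true <-> In (lab u) s.
Proof.
  unfold labelled; rewrite existsb_exists; split.
  - intros [x [Hx E]]; apply Nat.eqb_eq in E; subst; auto.
  - intros H; exists (lab u); rewrite Nat.eqb_refl; auto.
Qed.

Lemma count_labelled {A} (lab : A -> nat) s W : NoDup s ->
  let c j := length (filter (labelled lab [j]) W) in
  list_sum (map c s) = length (filter (labelled lab s) W).
Proof.
  intros Hs; cbv zeta; induction s as [|j s IH].
  - simpl; induction W; simpl; auto.
  - inversion Hs as [|? ? Hj Hs']; subst; cbn [map list_sum fold_right].
    fold (list_sum (map (fun j => length (filter (labelled lab [j]) W)) s)).
    rewrite (IH Hs'); clear IH.
    induction W as [|u W IHW]; auto; cbn [filter].
    change (labelled lab (j :: s) u) with (Nat.eqb (lab u) j || labelled lab s u)%bool.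
    change (labelled lab [j] u) with (Nat.eqb (lab u) j || false)%bool.
    destruct (Nat.eqb_spec (lab u) j) as [<-|Hne]; cbn [orb].
    + destruct (labelled lab s u) eqn:E; [apply labelled_iff in E; contradiction|].
      cbn [length]; lia.
    + destruct (labelled lab s u); cbn [length]; lia.
Qed.

Lemma light_labels {A} (lab : A -> nat) W N k : (k <= N)%nat ->
  exists s, NoDup s /\ incl s (seq 0 N) /\ length s = k /\
    (N * length (filter (labelled lab s) W) <= k * length W)%nat.
Proof.
  intros Hk.
  destruct (light_subset (fun j => length (filter (labelled lab [j]) W)) k (seq 0 N))
    as [s [H1 [H2 [H3 H4]]]]; [apply seq_NoDup | rewrite length_seq; auto|].
  exists s; repeat split; auto.
  rewrite !count_labelled, length_seq in H4; auto using seq_NoDup.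
  (* Elements of [W] may carry labels outside [seq 0 N], so the total weight is only bounded by
     [length W]. *)
  pose proof (filter_length_le (labelled lab (seq 0 N)) W); nia.
Qed.

(** * The separation argument *)

(** The common form of [PC_cantor] and [PC_unit]; with the spaces built explicitly, both are
    instances by conversion. *)
Definition positive_choice {X : Type} (cname : baire -> (X -> Prop) -> Prop)
  (pname : baire -> X -> Prop) (meas : (X -> Prop) -> R -> Prop) (eps : R) :
  Build_RepSpace (X -> Prop) cname -> Build_RepSpace X pname -> Prop :=
  fun A x => (exists m, meas A m /\ eps < m) /\ A x.

Definition zeros : baire := fun _ => 0%nat.

(* [beta] covers the space by Cantor space and [nb] lifts it to names. A label
   [cls s j] of a point name [s] is decided by finitely many entries of [s]. *)
Record layout {X : Type} (cname : baire -> (X -> Prop) -> Prop)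
  (pname : baire -> X -> Prop) (meas : (X -> Prop) -> R -> Prop)
  (beta : cantor -> X) (nb : cantor -> baire) : Prop := {
  lay_ext : forall r A A', cname r A -> cname r A' -> A = A';
  lay_onto : forall r A x, cname r A -> A x -> exists b, beta b = x;
  lay_name : forall b, pname (nb b) (beta b);
  lay_cont : forall k b b', agree k b b' -> agree k (nb b) (nb b');
  lay_open : forall r A b, cname r A -> ~ A (beta b) ->
    exists k, forall r' A' b', agree k r r' -> agree k b b' -> cname r' A' -> ~ A' (beta b');
  lay_upper : forall r A L W m, cname r A ->
    (forall b, A (beta b) -> exists w, In w W /\ bprefix w b) ->
    (forall w, In w W -> length w = L) -> meas A m -> m <= INR (length W) / 2 ^ L;
  lay_full : forall eps, eps < 1 ->
    exists A x, cname zeros A /\ A x /\ exists m, meas A m /\ eps < m;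
  lay_labels : forall eps n k, (0 < k <= 2 ^ n)%nat -> eps < INR k / 2 ^ n ->
    exists (cls : baire -> nat -> Prop) M,
      (forall s s' j, agree M s s' -> cls s j -> cls s' j) /\
      (forall s i j, cls s i -> cls s j -> i = j) /\
      forall S t, NoDup S -> incl S (seq 0 (2 ^ n)) -> length S = k ->
        exists p A x, agree t zeros p /\ cname p A /\ A x /\
          (exists m, meas A m /\ eps < m) /\
          forall s y, pname s y -> A y -> exists j, In j S /\ cls s j
}.

(** Choose 2^-n below [delta - eps] and let k be the integer [up (eps * 2^n)], which exceeds its
    argument strictly and by at most 1. Strictness also makes k positive when [eps = 0]. *)
Lemma dyadic_between eps delta : 0 <= eps -> eps < delta -> delta <= 1 ->
  exists n k, (0 < k <= 2 ^ n)%nat /\ eps < INR k / 2 ^ n < delta.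
Proof.
  intros H0 Hlt H1.
  destruct (pow_lt_1_zero (/ 2)) with (y := delta - eps) as [n Hn];
    [rewrite Rabs_pos_eq; lra | lra |].
  specialize (Hn n (le_n n)); rewrite Rabs_pos_eq in Hn by (apply pow_le; lra).
  rewrite pow_inv in Hn.
  assert (H2 : 0 < 2 ^ n) by (apply pow_lt; lra).
  destruct (archimed (eps * 2 ^ n)) as [Ha Hb].
  set (z := up (eps * 2 ^ n)) in *.
  assert (Hz : (0 < z)%Z) by (apply lt_IZR; nra).
  assert (Hd : IZR z < delta * 2 ^ n).
  { apply Rle_lt_trans with (eps * 2 ^ n + 1); [lra|].
    apply Rmult_lt_compat_r with (r := 2 ^ n) in Hn; auto.
    rewrite Rinv_l in Hn; lra. }
  exists n, (Z.to_nat z).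
  assert (E : INR (Z.to_nat z) = IZR z) by (rewrite INR_IZR_INZ, Z2Nat.id; auto; lia).
  rewrite E; repeat split.
  - lia.
  - apply INR_le; rewrite E, pow_INR; change (INR 2) with 2; nra.
  - apply Rmult_lt_reg_r with (2 ^ n); auto; unfold Rdiv; rewrite Rmult_assoc, Rinv_l; lra.
  - apply Rmult_lt_reg_r with (2 ^ n); auto; unfold Rdiv; rewrite Rmult_assoc, Rinv_l; lra.
Qed.

(** Covers the outer functions of both reductions: the strong one ignores its first argument. *)
Definition continuous2 (H : baire -> baire -> option baire) := forall p s q M, H p s = Some q ->
  exists k, forall p' s' q', H p' s' = Some q' -> agree k p p' -> agree k s s' -> agree M q q'.

Lemma bpair_agree k p p' s s' : agree k p p' -> agree k s s' -> agree k (bpair p s) (bpair p' s').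
Proof.
  intros Hp Hs i Hi; unfold bpair.
  assert (Hd : (Nat.div2 i < k)%nat) by (pose proof (Nat.div2_decr i i); lia).
  destruct (Nat.even i); auto.
Qed.

Lemma continuous2_weak H : continuous H -> continuous2 (fun p s => H (bpair p s)).
Proof.
  intros HH p s q M E; destruct (HH _ _ M E) as [k Hk].
  exists k; intros p' s' q' E' Hp Hs; apply (Hk _ _ E'); apply bpair_agree; auto.
Qed.

Lemma continuous2_strong H : continuous H -> continuous2 (fun p s => H s).
Proof.
  intros HH p s q M E; destruct (HH _ _ M E) as [k Hk].
  exists k; intros p' s' q' E' Hp Hs; apply (Hk _ _ E'); auto.
Qed.

Section Separation.
Context {X : Type} {cname : baire -> (X -> Prop) -> Prop} {pname : baire -> X -> Prop}
  {meas : (X -> Prop) -> R -> Prop} {beta : cantor -> X} {nb : cantor -> baire}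
  (Lay : layout cname pname meas beta nb)
  {eps delta : R} {H : baire -> baire -> option baire} {K : baire -> option baire}
  (Hred : forall G, realizes (positive_choice cname pname meas delta) G ->
    realizes (positive_choice cname pname meas eps)
      (fun p => obind (K p) (fun r => obind (G r) (fun s => H p s)))).

(* A realizer may answer [K p] by any given point of the named set, and may be
   undefined on everything that names no admissible set. *)
Lemma reduction_behaviour p A x :
  cname p A -> A x -> (exists m, meas A m /\ eps < m) ->
  exists r B, K p = Some r /\ cname r B /\ (exists m, meas B m /\ delta < m) /\
    forall b, B (beta b) -> exists s y, H p (nb b) = Some s /\ pname s y /\ A y.
Proof.
  intros HpA HAx Hm.
  set (g := positive_choice cname pname meas delta) in *.
  assert (HG : exists G, realizes g G /\
    (forall r, ~ (exists B y, cname r B /\ g B y) -> G r = None)).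
  { exists (fun r => match excluded_middle_informative (exists q B y, cname r B /\ pname q y /\ g B y)
                    with left E => Some (proj1_sig (constructive_indefinite_description _ E))
                       | right _ => None end).
    split.
    - intros r B HB [y Hy]; cbn in HB.
      destruct (excluded_middle_informative _) as [E|E].
      + destruct (constructive_indefinite_description _ E) as [q [B' [y' [HB' [Hq Hy']]]]].
        exists q; split; auto; exists y'; split; auto.
        rewrite (lay_ext _ _ _ _ _ Lay _ _ _ HB HB'); auto.
      + exfalso; apply E; destruct (lay_onto _ _ _ _ _ Lay _ _ _ HB (proj2 Hy)) as [b <-].
        exists (nb b), B, (beta b); split; auto; split; auto; apply (lay_name _ _ _ _ _ Lay).
    - intros r Hr; destruct (excluded_middle_informative _) as [[q [B [y [HB [Hq Hy]]]]]|]; auto.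
      exfalso; apply Hr; eauto. }
  destruct HG as [G [HG HGnone]].
  assert (Hdom : exists y, positive_choice cname pname meas eps A y) by (exists x; split; auto).
  destruct (Hred G HG p A HpA Hdom) as [q [Hq _]].
  destruct (K p) as [r|] eqn:EK; [|discriminate]; simpl in Hq.
  (* Otherwise this [G] would be undefined at [r], although the composition has the value [q]. *)
  assert (Hr : exists B y, cname r B /\ g B y).
  { apply NNPP; intros Hno; rewrite HGnone in Hq; auto; discriminate. }
  destruct Hr as [B [y0 [HB [HmB Hy0]]]].
  exists r, B; repeat split; auto.
  intros b Hb.
  (* Changing the realizer at the single input [r] prescribes the answer [nb b]. *)
  set (G' := fun r' => if excluded_middle_informative (r' = r) then Some (nb b) else G r').
  assert (HG' : realizes g G').
  { intros r' B' HB' Hy; unfold G'; destruct (excluded_middle_informative _) as [->|]; auto.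
    exists (nb b); split; auto; exists (beta b); split; [apply (lay_name _ _ _ _ _ Lay)|].
    rewrite (lay_ext _ _ _ _ _ Lay _ _ _ HB' HB); split; auto. }
  destruct (Hred G' HG' p A HpA Hdom) as [s [Hs [y [Hy [_ HAy]]]]].
  rewrite EK in Hs; simpl in Hs; unfold G' in Hs.
  destruct (excluded_middle_informative (r = r)) as [_|]; [|contradiction].
  exists s, y; auto.
Qed.

(* Given the empty name [zeros] of the full space, compactness yields a depth [L]
   at which the first [L] bits of [b] determine the label of the output. *)
Lemma labels_determined (HH : continuous2 H) (HK : continuous K) (Heps : eps < 1)
  (cls : baire -> nat -> Prop) M
  (Hloc : forall s s' j, agree M s s' -> cls s j -> cls s' j)
  (Hfun : forall s i j, cls s i -> cls s j -> i = j) :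
  exists L (lab : list bool -> nat), forall p r B b s j,
    agree L zeros p -> K p = Some r -> cname r B -> B (beta b) ->
    H p (nb b) = Some s -> cls s j -> lab (restrict b L) = j.
Proof.
  destruct (lay_full _ _ _ _ _ Lay eps Heps) as [A0 [x0 [HA0 [Hx0 Hm0]]]].
  destruct (reduction_behaviour zeros A0 x0 HA0 Hx0 Hm0) as [r0 [B0 [EK0 [HB0 [_ Hout]]]]].
  set (P := fun w => exists i, forall p r B b s j,
    agree (length w) zeros p -> bprefix w b -> K p = Some r -> cname r B -> B (beta b) ->
    H p (nb b) = Some s -> cls s j -> i = j).
  destruct (fan P) as [L HL].
  - intros w v [i Hi]; exists i; intros p r B b s j Hp Hb.
    apply Hi.
    + apply agree_le with (2 := Hp); rewrite length_app; lia.
    + intros a Ha; rewrite <- (Hb a); [rewrite app_nth1; auto | rewrite length_app; lia].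
  - intros b.
    assert (Hpre : forall k b', bprefix (restrict b k) b' -> agree k b b').
    { intros k b' Hb i Hi; rewrite <- (Hb i), restrict_nth; auto; rewrite restrict_length; auto. }
    destruct (classic (B0 (beta b))) as [Hb|Hb].
    + destruct (Hout b Hb) as [s0 [y0 [Es0 _]]].
      destruct (HH _ _ _ M Es0) as [k Hk]; exists k.
      (* If [s0] has no label, then by [Hloc] neither has any output close to it, and the default 0
         is vacuously correct. *)
      assert (Hi : exists i, forall j, cls s0 j -> i = j).
      { destruct (classic (exists i, cls s0 i)) as [[i Hi]|Hno].
        - exists i; intros j; apply Hfun; auto.
        - exists 0%nat; intros j Hj; exfalso; eauto. }
      destruct Hi as [i Hi]; exists i; intros p r B b' s j Hp Hb' _ _ _ Es Hj.
      rewrite restrict_length in Hp; apply Hi; apply Hloc with (2 := Hj), agree_sym.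
      apply (Hk _ _ _ Es); auto; apply (lay_cont _ _ _ _ _ Lay); auto.
    (* Here a finite part of [r0] already excludes all points near [beta b]. By continuity [K]
       repeats that part on nearby names, so no input near [b] has to be answered and the label is
       arbitrary. *)
    + destruct (lay_open _ _ _ _ _ Lay _ _ _ HB0 Hb) as [k1 Hk1].
      destruct (HK _ _ k1 EK0) as [k2 Hk2]; exists (max k1 k2), 0%nat.
      intros p r B b' s j Hp Hb' EK HB HBb; exfalso.
      rewrite restrict_length in Hp.
      apply (Hk1 r B b'); auto.
      * apply (Hk2 _ _ EK), agree_le with (2 := Hp); lia.
      * apply agree_le with (k' := max k1 k2); [lia | auto].
  - exists L.
    assert (Hlab : forall w, exists i, length w = L -> forall p r B b s j,
      agree (length w) zeros p -> bprefix w b -> K p = Some r -> cname r B -> B (beta b) ->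
      H p (nb b) = Some s -> cls s j -> i = j).
    { intros w; destruct (Nat.eq_dec (length w) L) as [Hw|Hw].
      - destruct (HL w Hw) as [i Hi]; exists i; auto.
      - exists 0%nat; contradiction. }
    exists (fun w => proj1_sig (constructive_indefinite_description _ (Hlab w))).
    intros p r B b s j Hp EK HB HBb Es Hj.
    destruct (constructive_indefinite_description _ _) as [i Hi]; simpl.
    apply (Hi (restrict_length b L) p r B b s); auto using bprefix_restrict.
    rewrite restrict_length; auto.
Qed.

Lemma separation : continuous2 H -> continuous K -> 0 <= eps -> delta <= 1 -> delta <= eps.
Proof.
  intros HH HK H0 H1; apply Rnot_lt_le; intros Hlt.
  destruct (dyadic_between eps delta H0 Hlt H1) as [n [k [Hk [Hek Hkd]]]].
  destruct (lay_labels _ _ _ _ _ Lay eps n k Hk Hek) as [cls [M [Hloc [Hfun Hsets]]]].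
  destruct (labels_determined HH HK ltac:(lra) cls M Hloc Hfun) as [L [lab Hlab]].
  destruct (light_labels lab (words L) (2 ^ n) k) as [S [HS1 [HS2 [HS3 HS4]]]]; [lia|].
  (* The delay is [L], so [p] still looks like [zeros] to the depth at which [lab] is valid. *)
  destruct (Hsets S L HS1 HS2 HS3) as [p [A [x [Hp [HA [Hx [Hm Hcls]]]]]]].
  destruct (reduction_behaviour p A x HA Hx Hm) as [r [B [EK [HB [[m [Hm1 Hm2]] Hout]]]]].
  set (W := filter (labelled lab S) (words L)) in *.
  assert (Hup : m <= INR (length W) / 2 ^ L).
  { apply (lay_upper _ _ _ _ _ Lay r B L W m HB); auto.
    - intros b Hb; exists (restrict b L); split; [|apply bprefix_restrict].
      destruct (Hout b Hb) as [s [y [Es [Hs Hy]]]].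
      destruct (Hcls s y Hs Hy) as [j [Hj Hsj]].
      apply filter_In; split; [apply in_words, restrict_length|].
      apply labelled_iff; rewrite (Hlab p r B b s j); auto.
    - intros w Hw; apply filter_In in Hw as [Hw _]; apply in_words; auto. }
  rewrite words_length in HS4; apply le_INR in HS4.
  rewrite !mult_INR, !pow_INR in HS4; change (INR 2) with 2 in HS4.
  assert (HL : 0 < 2 ^ L) by (apply pow_lt; lra).
  assert (Hn : 0 < 2 ^ n) by (apply pow_lt; lra).
  assert (INR (length W) / 2 ^ L <= INR k / 2 ^ n); [|lra].
  apply Rmult_le_reg_r with (2 ^ n * 2 ^ L); [nra|].
  replace (INR (length W) / 2 ^ L * (2 ^ n * 2 ^ L)) with (2 ^ n * INR (length W)) by (field; lra).
  replace (INR k / 2 ^ n * (2 ^ n * 2 ^ L)) with (INR k * 2 ^ L) by (field; lra).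
  auto.
Qed.

End Separation.

(** * Binary expansions *)

Fixpoint nval (b : cantor) (n : nat) : nat :=
  match n with O => O | S m => (2 * nval b m + Nat.b2n (b m))%nat end.

(** Makes [nval] and [dlow] applicable to words; evaluated at depth [length w] they do not read the
    padding. *)
Definition extend (w : list bool) : cantor := fun i => nth i w false.

Lemma nval_agree b b' n : agree n b b' -> nval b n = nval b' n.
Proof.
  induction n; auto; intros H; cbn [nval].
  rewrite IHn, (H n); auto; apply agree_le with (2 := H); auto.
Qed.

Lemma nval_onto n j : (j < 2 ^ n)%nat -> exists b, nval b n = j.
Proof.
  revert j; induction n; intros j Hj.
  { exists (fun _ => true); simpl in *; lia. }
  destruct (IHn (Nat.div2 j)) as [b Hb].
  { pose proof (Nat.div2_odd j); cbn [Nat.pow] in Hj; lia. }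
  exists (fun i => if i <? n then b i else Nat.odd j); cbn [nval].
  rewrite (nval_agree _ b); [|intros i Hi; apply Nat.ltb_lt in Hi; rewrite Hi; auto].
  rewrite Hb, Nat.ltb_irrefl; symmetry; apply Nat.div2_odd.
Qed.

Lemma pow2_pos n : 0 < 2 ^ n.
Proof. apply pow_lt; lra. Qed.

Lemma half_pow n : (/ 2) ^ n = / 2 ^ n.
Proof. apply pow_inv. Qed.

Definition dlow b n := INR (nval b n) * (/ 2) ^ n.

Lemma dlow_step b n : dlow b n <= dlow b (S n) /\ dlow b (S n) + (/ 2) ^ S n <= dlow b n + (/ 2) ^ n.
Proof.
  unfold dlow; cbn [nval pow]; rewrite plus_INR, mult_INR; change (INR 2) with 2.
  assert (0 < (/ 2) ^ n) by (apply pow_lt; lra).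
  assert (Hb : 0 <= INR (Nat.b2n (b n)) <= 1) by (destruct (b n); simpl; lra).
  split; nra.
Qed.

(** The dyadic intervals of [b] are nested, so those at depths [n] and [m] both contain the one at
    depth [n + m]. *)
Lemma dlow_bounds b n m : dlow b n <= dlow b m + (/ 2) ^ m.
Proof.
  assert (Hlow : forall d, dlow b n <= dlow b (n + d)).
  { induction d; [rewrite Nat.add_0_r; lra|].
    rewrite Nat.add_succ_r; pose proof (dlow_step b (n + d)); lra. }
  assert (Hhigh : forall d, dlow b (m + d) + (/ 2) ^ (m + d) <= dlow b m + (/ 2) ^ m).
  { induction d; [rewrite Nat.add_0_r; lra|].
    rewrite Nat.add_succ_r; pose proof (dlow_step b (m + d)); lra. }
  specialize (Hlow m); specialize (Hhigh n); rewrite (Nat.add_comm m n) in Hhigh.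
  assert (0 < (/ 2) ^ (n + m)) by (apply pow_lt; lra); lra.
Qed.

Lemma binary_value_exists b : exists x, forall n, dlow b n <= x <= dlow b n + (/ 2) ^ n.
Proof.
  destruct (completeness (fun y => exists n, y = dlow b n)) as [x [Hub Hlub]].
  - exists (dlow b 0 + (/ 2) ^ 0); intros y [n ->]; apply dlow_bounds.
  - exists (dlow b 0), 0%nat; auto.
  - exists x; intros n; split; [apply Hub; eauto|].
    apply Hlub; intros y [m ->]; apply dlow_bounds.
Qed.

Definition beta (b : cantor) : R :=
  proj1_sig (constructive_indefinite_description _ (binary_value_exists b)).

Lemma beta_spec b n : dlow b n <= beta b <= dlow b n + (/ 2) ^ n.
Proof. unfold beta; destruct (constructive_indefinite_description _ _); auto. Qed.

Lemma beta_unit b : 0 <= beta b <= 1.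
Proof. pose proof (beta_spec b 0); unfold dlow in *; simpl in *; lra. Qed.

Lemma half_pow_small eta : 0 < eta -> exists n, (/ 2) ^ n < eta.
Proof.
  intros H; destruct (pow_lt_1_zero (/ 2)) with (y := eta) as [n Hn];
    [rewrite Rabs_pos_eq; lra | lra |].
  exists n; specialize (Hn n (le_n n)); rewrite Rabs_pos_eq in Hn; auto.
  apply pow_le; lra.
Qed.

Lemma dlow_agree b b' n : agree n b b' -> dlow b n = dlow b' n.
Proof. intros H; unfold dlow; rewrite (nval_agree _ _ _ H); auto. Qed.

Lemma beta_near b b' n : agree n b b' -> Rabs (beta b - beta b') <= (/ 2) ^ n.
Proof.
  intros H; pose proof (beta_spec b n); pose proof (beta_spec b' n).
  rewrite (dlow_agree _ _ _ H) in *; apply Rabs_le; lra.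
Qed.

(** Greedy expansion: a bit is set as soon as [x] reaches the midpoint of the current interval. For
    [x = 1] this gives all ones. *)
Lemma beta_onto x : 0 <= x <= 1 -> exists b, beta b = x.
Proof.
  intros Hx.
  set (digit := fun v n => if Rle_dec (INR (2 * v + 1) * (/ 2) ^ S n) x then true else false).
  set (v := fix v n := match n with O => O | S m => (2 * v m + Nat.b2n (digit (v m) m))%nat end).
  assert (Hv : forall n, INR (v n) * (/ 2) ^ n <= x <= INR (v n) * (/ 2) ^ n + (/ 2) ^ n).
  { induction n as [|n IH]; [simpl; lra|].
    cbn [v]; unfold digit; destruct (Rle_dec _ _) as [Hd|Hd]; cbn [pow Nat.b2n] in *;
      rewrite plus_INR, mult_INR in *; change (INR 2) with 2 in *; simpl (INR 1) in *;
      simpl (INR 0); lra. }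
  set (b := fun n => digit (v n) n).
  assert (E : forall n, nval b n = v n).
  { induction n; auto; cbn [nval v]; rewrite IHn; auto. }
  exists b; apply cond_eq; intros eta Heta.
  destruct (half_pow_small eta Heta) as [n Hn].
  pose proof (beta_spec b n) as Hb; unfold dlow in Hb; rewrite E in Hb.
  specialize (Hv n); apply Rabs_def1; lra.
Qed.

(** * Covers *)

(** Covers in the measures are infinite sequences; this places a finite family in front of one. *)
Fixpoint prep {T} (l : list T) (c : nat -> T) : nat -> T :=
  match l with
  | [] => c
  | x :: l' => fun i => match i with O => x | S j => prep l' c j end
  end.

Definition rsum {T} (f : T -> R) (l : list T) : R := fold_right (fun x s => f x + s) 0 l.

Lemma prep_in {T} (l : list T) c x : In x l -> exists i, prep l c i = x.
Proof.
  induction l as [|y l IH]; [intros []|]; intros [->|H].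
  - exists 0%nat; auto.
  - destruct (IH H) as [i Hi]; exists (S i); auto.
Qed.

Lemma prep_tail {T} (l : list T) c j : exists i, prep l c i = c j.
Proof.
  induction l as [|y l [i Hi]]; [exists j; auto | exists (S i); auto].
Qed.

Lemma prep_all {T} (P : T -> Prop) l c :
  (forall x, In x l -> P x) -> (forall i, P (c i)) -> forall i, P (prep l c i).
Proof.
  intros Hl Hc; induction l as [|y l IH]; auto; intros [|i]; simpl; auto with datatypes.
Qed.

Lemma psum_S_left f N : psum f (S N) = f 0%nat + psum (fun i => f (S i)) N.
Proof. induction N; simpl in *; [lra|]; rewrite IHN; lra. Qed.

Lemma psum_le f g N : (forall i, f i <= g i) -> psum f N <= psum g N.
Proof. intros H; induction N; simpl; [lra|]; specialize (H N); lra. Qed.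

Lemma psum_plus f g N : psum (fun i => f i + g i) N = psum f N + psum g N.
Proof. induction N; simpl; [lra|]; rewrite IHN; lra. Qed.

Lemma psum_geometric eta N : 0 <= eta -> psum (fun i => eta * (/ 2) ^ S i) N <= eta.
Proof.
  intros H; assert (E : psum (fun i => eta * (/ 2) ^ S i) N = eta * (1 - (/ 2) ^ N)).
  { induction N; cbn [psum pow] in *; [lra|]; rewrite IHN; lra. }
  rewrite E; assert (0 < (/ 2) ^ N) by (apply pow_lt; lra); nra.
Qed.

Lemma rsum_nonneg {T} (f : T -> R) l : (forall x, In x l -> 0 <= f x) -> 0 <= rsum f l.
Proof.
  induction l as [|x l IH]; simpl; intros H; [lra|].
  assert (0 <= f x) by auto; assert (0 <= rsum f l) by auto; lra.
Qed.

Lemma rsum_const {T} (f : T -> R) l v :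
  (forall x, In x l -> f x = v) -> rsum f l = INR (length l) * v.
Proof.
  induction l as [|x l IH]; intros H; [simpl; lra|].
  cbn [rsum fold_right length]; fold (rsum f l).
  rewrite S_INR, IH, (H x); auto with datatypes; lra.
Qed.

Lemma rsum_app {T} (f : T -> R) l l' : rsum f (l ++ l') = rsum f l + rsum f l'.
Proof. unfold rsum; induction l; simpl; lra. Qed.

Lemma psum_prep {T} (f : T -> R) l c r : (forall x, In x l -> 0 <= f x) ->
  (forall N, psum (fun i => f (c i)) N <= r) ->
  forall N, psum (fun i => f (prep l c i)) N <= rsum f l + r.
Proof.
  intros Hl Hc; induction l as [|x l IH]; intros N; [simpl; specialize (Hc N); lra|].
  cbn [rsum fold_right]; fold (rsum f l).
  destruct N as [|N].
  - pose proof (rsum_nonneg f (x :: l) Hl) as H; cbn [rsum fold_right] in H.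
    fold (rsum f l) in H; specialize (Hc 0%nat); simpl in *; lra.
  - rewrite psum_S_left; simpl.
    specialize (IH ltac:(auto with datatypes) N); lra.
Qed.

(** The infimum is obtained as a supremum of the reflected set, and the lower bound [l] keeps it
    above [e]. *)
Lemma is_glb_gt (S : R -> Prop) e l : (exists r, S r) -> (forall r, S r -> l <= r) -> e < l ->
  exists m, is_glb S m /\ e < m.
Proof.
  intros [r0 Hr0] Hl He.
  destruct (completeness (fun y => S (- y))) as [m [Hub Hlub]].
  - exists (- l); intros y Hy; specialize (Hl _ Hy); lra.
  - exists (- r0); rewrite Ropp_involutive; auto.
  - exists (- m); repeat split.
    + intros r Hr; assert (- r <= m); [|lra].
      apply Hub; rewrite Ropp_involutive; auto.
    + intros l' Hl'; assert (m <= - l'); [|lra].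
      apply Hlub; intros y Hy; specialize (Hl' _ Hy); lra.
    + assert (m <= - l); [|lra]; apply Hlub; intros y Hy; specialize (Hl _ Hy); lra.
Qed.

(* With [covered x i] the length of the part of the [i]-th interval to the left of [x],
   the largest [x] such that finitely many intervals cover length [x] to its left is [1]. *)
Lemma unit_cover_ge_1 a b r : (forall i, a i <= b i) ->
  (forall x, 0 <= x <= 1 -> exists i, a i < x < b i) ->
  (forall N, psum (fun i => b i - a i) N <= r) -> 1 <= r.
Proof.
  intros Hab Hcov Hr.
  set (covered := fun x i => Rmax 0 (Rmin (b i) x - a i)).
  set (T := fun x => 0 <= x <= 1 /\ exists n, x <= psum (covered x) n).
  assert (Hmono : forall x y i, x <= y -> covered x i <= covered y i).
  { intros x y i Hxy; unfold covered, Rmax, Rmin; repeat destruct (Rle_dec _ _); lra. }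
  assert (Hcov0 : forall x i, 0 <= covered x i) by (intros; apply Rmax_l).
  assert (Hext : forall x n d, psum (covered x) n <= psum (covered x) (n + d)).
  { intros x n d; induction d; [rewrite Nat.add_0_r; lra|].
    rewrite Nat.add_succ_r; simpl; specialize (Hcov0 x (n + d)%nat); lra. }
  (* Moving the cut from [t] to [x] inside interval [i] gains the full length [x - t] from that
     interval alone. *)
  assert (Hstep : forall t x n i, t <= x -> a i < t -> x < b i -> (i < n)%nat ->
            psum (covered t) n + (x - t) <= psum (covered x) n).
  { intros t x n i Htx Ha Hb Hi; induction n as [|n IH]; [lia|]; simpl.
    destruct (Nat.eq_dec i n) as [<-|Hne].
    - assert (covered t i + (x - t) <= covered x i).
      { unfold covered, Rmax, Rmin; repeat destruct (Rle_dec _ _); lra. }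
      pose proof (psum_le (covered t) (covered x) i (fun j => Hmono t x j Htx)); lra.
    - specialize (IH ltac:(lia)); specialize (Hmono t x n Htx); lra. }
  destruct (completeness T) as [s [Hub Hlub]].
  { exists 1; intros x [Hx _]; lra. }
  { exists 0; split; [lra|]; exists 0%nat; simpl; lra. }
  assert (Hs : 0 <= s <= 1).
  { split; [apply Hub; split; [lra|]; exists 0%nat; simpl; lra|].
    apply Hlub; intros x [Hx _]; lra. }
  destruct (Hcov s Hs) as [i [Hai Hbi]].
  assert (Ht : exists t, T t /\ a i < t).
  { apply NNPP; intros Hno; assert (s <= a i); [|lra].
    apply Hlub; intros x Hx; apply Rnot_lt_le; intros Hlt; eauto. }
  destruct Ht as [t [[Ht [n Hn]] Hat]].
  assert (Hts : t <= s) by (apply Hub; split; eauto).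
  (* This point lies beyond the supremum [s] unless [s = 1]; since it will turn out to be in [T], it
     must equal 1. *)
  set (x := Rmin 1 ((s + b i) / 2)).
  assert (Hx : t <= x /\ x < b i /\ 0 <= x <= 1).
  { unfold x, Rmin; destruct (Rle_dec _ _); lra. }
  assert (HTx : x <= psum (covered x) (n + S i)).
  { pose proof (Hstep t x (n + S i)%nat i ltac:(lra) Hat ltac:(lra) ltac:(lia)).
    specialize (Hext t n (S i)); lra. }
  assert (Hxs : x <= s) by (apply Hub; split; [lra | eauto]).
  assert (Hx1 : x = 1).
  { unfold x, Rmin in *; destruct (Rle_dec _ _); lra. }
  apply Rle_trans with (2 := Hr (n + S i)%nat).
  rewrite Hx1 in HTx; apply Rle_trans with (1 := HTx), psum_le.
  intros j; unfold covered, Rmax, Rmin; specialize (Hab j); repeat destruct (Rle_dec _ _); lra.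
Qed.

Lemma bprefix_dlow w b : bprefix w b -> dlow b (length w) = dlow (extend w) (length w).
Proof. intros H; apply dlow_agree; intros i Hi; symmetry; apply H; auto. Qed.

(** [beta] sends a cylinder into a closed dyadic interval of the same measure, so the bound is
    inherited from the unit interval. Enlarging the i-th interval by [e i] on both sides makes it
    open, at a total cost of at most [eta]. *)
Lemma cantor_cover_ge_1 c r : (forall x, exists i, bprefix (c i) x) ->
  (forall N, psum (fun i => (/ 2) ^ length (c i)) N <= r) -> 1 <= r.
Proof.
  intros Hcov Hr; apply le_epsilon; intros eta Heta.
  set (lo := fun i => dlow (extend (c i)) (length (c i))).
  set (e := fun i => eta / 2 * (/ 2) ^ S i).
  assert (He : forall i, 0 < e i).
  { intros i; apply Rmult_lt_0_compat; [lra | apply pow_lt; lra]. }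
  apply (unit_cover_ge_1 (fun i => lo i - e i) (fun i => lo i + (/ 2) ^ length (c i) + e i)).
  - intros i; specialize (He i); assert (0 < (/ 2) ^ length (c i)) by (apply pow_lt; lra); lra.
  - intros x Hx; destruct (beta_onto x Hx) as [b <-]; destruct (Hcov b) as [i Hi].
    exists i; pose proof (beta_spec b (length (c i))) as Hb.
    rewrite (bprefix_dlow _ _ Hi) in Hb; specialize (He i); unfold lo; lra.
  - intros N; apply Rle_trans with
      (psum (fun i => (/ 2) ^ length (c i) + (e i + e i)) N).
    { apply psum_le; intros i; lra. }
    rewrite !psum_plus; specialize (Hr N).
    pose proof (psum_geometric (eta / 2) N ltac:(lra)); unfold e; lra.
Qed.

(** * Measure bounds from finite covers *)

Lemma cantor_measure_gt A l eps : (forall x, ~ A x -> exists w, In w l /\ bprefix w x) ->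
  rsum (fun w => (/ 2) ^ length w) l < 1 - eps -> exists m, cantor_measure A m /\ eps < m.
Proof.
  intros Hl Hs; set (f := fun w : list bool => (/ 2) ^ length w) in *.
  apply is_glb_gt with (1 - rsum f l); [| |lra].
  (* The empty word covers everything. No cylinder has measure 0, so the sequence is filled up with
     words of length i + 1, of total measure at most 1. *)
  - exists (1 + 1), (prep [[]] (fun i => repeat true (S i))); split.
    + intros x _; exists 0%nat; intros i Hi; simpl in Hi; lia.
    + intros N; apply Rle_trans with (rsum f [[]] + 1); [|unfold f; simpl; lra].
      apply (psum_prep f).
      * intros x _; apply pow_le; lra.
      * intros N'; apply Rle_trans with (2 := psum_geometric 1 N' ltac:(lra)).
        apply psum_le; intros i; unfold f; rewrite repeat_length; lra.
  - intros r [c [Hc Hr]].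
    (* A cover of [A] together with [l] covers the whole space. *)
    assert (1 <= rsum f l + r); [|lra].
    apply (cantor_cover_ge_1 (prep l c)).
    + intros x; destruct (classic (A x)) as [Hx|Hx].
      * destruct (Hc x Hx) as [j Hj]; destruct (prep_tail l c j) as [i Hi].
        exists i; rewrite Hi; auto.
      * destruct (Hl x Hx) as [w [Hw Hwx]]; destruct (prep_in l c w Hw) as [i Hi].
        exists i; rewrite Hi; auto.
    + apply (psum_prep f); auto; intros x _; apply pow_le; lra.
Qed.

Lemma cantor_measure_le A L W m :
  (forall b, A b -> exists w, In w W /\ bprefix w b) -> (forall w, In w W -> length w = L) ->
  cantor_measure A m -> m <= INR (length W) / 2 ^ L.
Proof.
  intros HA HW [Hm _]; apply le_epsilon; intros eta Heta.
  destruct (half_pow_small eta Heta) as [P HP].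
  set (f := fun w : list bool => (/ 2) ^ length w).
  replace (INR (length W) / 2 ^ L) with (rsum f W).
  2:{ unfold Rdiv; rewrite <- half_pow; apply rsum_const.
      intros w Hw; unfold f; rewrite HW; auto. }
  apply Rle_trans with (rsum f W + (/ 2) ^ P); [|lra].
  (* The filler words have total measure at most 2^-P, which is below [eta]. *)
  apply Hm; exists (prep W (fun i => repeat true (P + S i))); split.
  - intros b Hb; destruct (HA b Hb) as [w [Hw Hwb]].
    destruct (prep_in W (fun i => repeat true (P + S i)) w Hw) as [i Hi].
    exists i; rewrite Hi; auto.
  - apply (psum_prep f).
    + intros x _; apply pow_le; lra.
    + intros N; apply Rle_trans with (2 := psum_geometric ((/ 2) ^ P) N ltac:(apply pow_le; lra)).
      apply psum_le; intros i; unfold f; rewrite repeat_length, pow_add; lra.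
Qed.

Definition ilen (I : R * R) := snd I - fst I.

Lemma lebesgue_measure_gt A (l : list (R * R)) eps : (forall x, A x -> 0 <= x <= 1) ->
  (forall I, In I l -> fst I <= snd I) ->
  (forall x, 0 <= x <= 1 -> ~ A x -> exists I, In I l /\ fst I < x < snd I) ->
  rsum ilen l < 1 - eps -> exists m, lebesgue_measure A m /\ eps < m.
Proof.
  intros HA Hl Hcov Hs; apply is_glb_gt with (1 - rsum ilen l); [| |lra].
  - set (c := prep [(-1, 2)] (fun _ => (0, 0))).
    exists (rsum ilen [(-1, 2)] + 0), (fun i => fst (c i)), (fun i => snd (c i)); split; [|split].
    + apply prep_all with (P := fun I => fst I <= snd I); simpl; intros;
        [destruct H as [<-|[]]; simpl|]; lra.
    + intros x Hx; exists 0%nat; specialize (HA x Hx); simpl; lra.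
    + apply (psum_prep ilen); [intros x [<-|[]]; unfold ilen; simpl; lra|].
      intros N; unfold ilen; simpl; induction N; simpl; lra.
  - intros r [a [b [Hab [Hc Hr]]]].
    assert (1 <= rsum ilen l + r); [|lra].
    set (c := fun i => (a i, b i)).
    apply (unit_cover_ge_1 (fun i => fst (prep l c i)) (fun i => snd (prep l c i))).
    + apply prep_all with (P := fun I => fst I <= snd I); auto.
    + intros x Hx; destruct (classic (A x)) as [HAx|HAx].
      * destruct (Hc x HAx) as [j Hj]; destruct (prep_tail l c j) as [i Hi].
        exists i; rewrite Hi; auto.
      * destruct (Hcov x Hx HAx) as [I [HI HIx]]; destruct (prep_in l c I HI) as [i Hi].
        exists i; rewrite Hi; auto.
    + apply (psum_prep ilen); auto.
      intros I HI; specialize (Hl I HI); unfold ilen; lra.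
Qed.

Lemma lebesgue_measure_le (A : R -> Prop) L W m : (forall x, A x -> 0 <= x <= 1) ->
  (forall b, A (beta b) -> exists w, In w W /\ bprefix w b) -> (forall w, In w W -> length w = L) ->
  lebesgue_measure A m -> m <= INR (length W) / 2 ^ L.
Proof.
  intros HA HAW HW [Hm _]; apply le_epsilon; intros eta Heta.
  (* Each of the [length W] closed intervals grows by [2 * e], less than [eta] in total; the 1 keeps
     the denominator positive when [W] is empty. *)
  set (e := eta / (2 * (INR (length W) + 1))).
  pose proof (pos_INR (length W)) as HWpos.
  assert (He : 0 < e) by (apply Rdiv_lt_0_compat; lra).
  assert (Hpow : 0 < (/ 2) ^ L) by (apply pow_lt; lra).
  set (interval := fun w => (dlow (extend w) L - e, dlow (extend w) L + (/ 2) ^ L + e)).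
  set (c := prep (map interval W) (fun _ => (0, 0))).
  apply Rle_trans with (rsum ilen (map interval W) + 0).
  - apply Hm; exists (fun i => fst (c i)), (fun i => snd (c i)); split; [|split].
    + apply prep_all with (P := fun I => fst I <= snd I); simpl; intros; [|lra].
      apply in_map_iff in H as [w [<- _]]; simpl; lra.
    + intros x Hx; destruct (beta_onto x (HA x Hx)) as [b <-].
      destruct (HAW b Hx) as [w [Hw Hwb]].
      destruct (prep_in (map interval W) (fun _ => (0, 0)) (interval w)) as [i Hi];
        [apply in_map; auto|].
      exists i; unfold c; rewrite Hi; simpl.
      pose proof (beta_spec b L) as Hb; pose proof (bprefix_dlow w b Hwb) as E.
      rewrite (HW w Hw) in E; rewrite E in Hb; lra.
    + apply (psum_prep ilen).
      * intros I HI; apply in_map_iff in HI as [w [<- _]]; unfold ilen; simpl; lra.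
      * intros N; unfold ilen; simpl; induction N; simpl; lra.
  - rewrite (rsum_const ilen _ ((/ 2) ^ L + 2 * e)).
    + rewrite length_map; unfold Rdiv; rewrite <- half_pow.
      assert (E : e * (2 * (INR (length W) + 1)) = eta) by (unfold e; field; lra).
      nra.
    + intros I HI; apply in_map_iff in HI as [w [<- _]]; unfold ilen; simpl; lra.
Qed.

(** Zeros announce nothing, so neither the initial segment nor the default after the end of [l]
    changes the named set. *)
Definition delayed (t : nat) (l : list nat) : baire :=
  fun i => if i <? t then 0%nat else nth (i - t) (map S l) 0%nat.

Lemma delayed_agree t l : agree t zeros (delayed t l).
Proof. intros i Hi; unfold delayed; apply Nat.ltb_lt in Hi; rewrite Hi; auto. Qed.

Lemma delayed_iff t l c : (exists i, delayed t l i = S c) <-> In c l.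
Proof.
  split.
  - intros [i Hi]; unfold delayed in Hi; destruct (i <? t); [discriminate|].
    destruct (nth_in_or_default (i - t) (map S l) 0%nat) as [H|H]; [|congruence].
    rewrite Hi, in_map_iff in H; destruct H as [c' [E Hc]]; injection E as ->; auto.
  - intros H; destruct (In_nth l c 0%nat H) as [i [Hi E]].
    exists (t + i)%nat; unfold delayed.
    rewrite (proj2 (Nat.ltb_ge _ _)) by lia.
    replace (t + i - t)%nat with i by lia.
    rewrite nth_indep with (d' := 1%nat) by (rewrite length_map; auto).
    rewrite map_nth, E; auto.
Qed.

(** Each label in [s] is attained on [W], so at least [length s] elements are filtered out. This
    bounds the measure removed to form the closed set. *)
Lemma unlabelled_length {A} (lab : A -> nat) W s : NoDup s -> incl s (map lab W) ->
  (length (filter (fun u => negb (labelled lab s u)) W) + length s <= length W)%nat.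
Proof.
  intros Hs Hincl.
  rewrite <- (filter_length (labelled lab s) W).
  assert (length s <= length (filter (labelled lab s) W))%nat; [|lia].
  rewrite <- (length_map lab (filter _ _)); apply NoDup_incl_length; auto.
  intros j Hj; specialize (Hincl j Hj); apply in_map_iff in Hincl as [u [<- Hu]].
  apply in_map, filter_In; split; auto; apply labelled_iff; auto.
Qed.

Lemma filter_unlabelled {A} (lab : A -> nat) W s u :
  In u (filter (fun u => negb (labelled lab s u)) W) <-> In u W /\ ~ In (lab u) s.
Proof.
  rewrite filter_In, negb_true_iff, <- labelled_iff; destruct (labelled lab s u);
    intuition congruence.
Qed.

(** * Cantor space *)

Definition bname (x : cantor) : baire := fun n => Nat.b2n (x n).

Definition cyl_code (w : list bool) : nat :=
  lcode (map (fun b : bool => if b then 1%nat else 0%nat) w).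

Lemma cyl_code_inj w w' : cyl_code w = cyl_code w' -> w = w'.
Proof.
  intros E; apply lcode_inj in E; revert w' E.
  induction w as [|[] w IH]; intros [|[] w'] E; try discriminate; auto;
    injection E as E; f_equal; auto.
Qed.

(** A negative name fixes only the complement; classically this determines the set. *)
Lemma complement_ext {T} (A A' : T -> Prop) : (forall x, ~ A x <-> ~ A' x) -> A = A'.
Proof.
  intros H; apply functional_extensionality; intros x; apply propositional_extensionality.
  specialize (H x); tauto.
Qed.

Lemma cantor_delayed_name t l A :
  (forall x, ~ A x <-> exists w, In w l /\ bprefix w x) ->
  cantor_closed_name (delayed t (map cyl_code l)) A.
Proof.
  intros H x; rewrite H; split.
  - intros [w [Hw Hx]]; apply (in_map cyl_code), (delayed_iff t) in Hw as [i Hi].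
    exists i, w; auto.
  - intros [i [w [Hi Hx]]]; exists w; split; auto.
    assert (Hw : In (cyl_code w) (map cyl_code l)) by (apply (delayed_iff t); exists i; exact Hi).
    apply in_map_iff in Hw as [w' [E Hw']]; apply cyl_code_inj in E; subst; auto.
Qed.

Lemma zeros_delayed : zeros = delayed 0 [].
Proof. apply functional_extensionality; intros [|i]; auto. Qed.

Lemma cantor_layout :
  layout cantor_closed_name (rep Cantor) cantor_measure (fun b => b) bname.
Proof.
  split.
  - intros r A A' H H'; apply complement_ext; intros x.
    rewrite (H x), (H' x); tauto.
  - intros r A x _ _; exists x; auto.
  - intros b n; unfold bname; destruct (b n); simpl; split; try tauto; try lia.
  - intros k b b' H i Hi; unfold bname; rewrite (H i Hi); auto.
  - intros r A b Hr Hb; apply Hr in Hb as [n [w [Hn Hw]]].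
    exists (max (S n) (length w)); intros r' A' b' Ha Hb' Hr'; apply Hr'.
    exists n, w; split; [rewrite <- (Ha n); auto; lia|].
    intros i Hi; rewrite (Hw i Hi); apply Hb'; lia.
  - intros r A L W m _; apply cantor_measure_le.
  - intros eps Heps; exists (fun _ => True), (fun _ => true).
    split; [|split; auto].
    + rewrite zeros_delayed; apply (cantor_delayed_name 0 []).
      intros x; split; [tauto | intros [w [[] _]]].
    + apply cantor_measure_gt with (l := []); [tauto | simpl; lra].
  - intros eps n k Hk Heps.
    set (lab := fun w => nval (extend w) n).
    exists (fun s j => nval (fun i => s i =? 1) n = j), n; split; [|split].
    + intros s s' j H <-; apply nval_agree; intros i Hi; rewrite (H i Hi); auto.
    + intros s i j; congruence.
    + intros S t HS1 HS2 HS3.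
      set (l := filter (fun w => negb (labelled lab S w)) (words n)).
      (* A clopen set: the union of the k cylinders whose words spell a number in [S]. Its
         complement is enumerated by [l]. *)
      set (A := fun x : cantor => In (nval x n) S).
      assert (Hpre : forall x w, length w = n -> bprefix w x -> lab w = nval x n).
      { intros x w Hw Hx; apply nval_agree; intros i Hi; apply Hx; lia. }
      assert (HA : forall x, ~ A x <-> exists w, In w l /\ bprefix w x).
      { intros x; split.
        - intros Hx; exists (restrict x n); split; [|apply bprefix_restrict].
          apply filter_unlabelled; split; [apply in_words, restrict_length|].
          rewrite (Hpre x); auto using restrict_length, bprefix_restrict.
        - intros [w [Hw Hwx]]; apply filter_unlabelled in Hw as [Hw HwS].
          rewrite (Hpre x) in HwS; auto; apply in_words; auto. }
      assert (Hx : exists x, A x).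
      { destruct S as [|j S]; [simpl in HS3; lia|].
        destruct (nval_onto n j) as [x Hx].
        - specialize (HS2 j (or_introl eq_refl)); apply in_seq in HS2; lia.
        - exists x; unfold A; rewrite Hx; left; auto. }
      destruct Hx as [x Hx].
      exists (delayed t (map cyl_code l)), A, x.
      split; [apply delayed_agree | split; [apply cantor_delayed_name; auto | split; [auto | split]]].
      * apply cantor_measure_gt with (l := l); [intros y; apply HA|].
        rewrite (rsum_const _ l ((/ 2) ^ n)).
        2:{ intros w Hw; apply filter_unlabelled in Hw as [Hw _].
            apply in_words in Hw; rewrite Hw; auto. }
        assert (Hlen : (length l + k <= 2 ^ n)%nat).
        { rewrite <- HS3, <- words_length; apply unlabelled_length; auto.
          intros j Hj; specialize (HS2 j Hj); apply in_seq in HS2.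
          destruct (nval_onto n j) as [y Hy]; [lia|].
          rewrite <- Hy, <- (Hpre y (restrict y n)); auto using restrict_length, bprefix_restrict.
          apply in_map, in_words, restrict_length. }
        apply le_INR in Hlen; rewrite plus_INR, pow_INR in Hlen; change (INR 2) with 2 in Hlen.
        unfold Rdiv in Heps; rewrite half_pow.
        assert (H2 : 0 < / 2 ^ n) by (apply Rinv_0_lt_compat, pow2_pos).
        apply Rmult_le_compat_r with (r := / 2 ^ n) in Hlen; [|lra].
        rewrite Rinv_r in Hlen by (apply Rgt_not_eq, pow2_pos); lra.
      * intros s y Hs Hy; exists (nval y n); split; auto.
        apply nval_agree; intros i _; destruct (Hs i) as [_ Hi].
        destruct (Nat.eqb_spec (s i) 1); destruct (y i); intuition congruence.
Qed.

(** * The unit interval *)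

Definition zcode (z : Z) : nat :=
  if (0 <=? z)%Z then (2 * Z.to_nat z)%nat else (2 * Z.to_nat (- z) - 1)%nat.

Lemma zint_zcode z : zint (zcode z) = IZR z.
Proof.
  unfold zint, zcode; destruct (Z.leb_spec 0 z) as [H|H].
  - rewrite Nat.even_even, Nat.div2_double, INR_IZR_INZ, Z2Nat.id; auto.
  - destruct (Z.to_nat (- z)) as [|m] eqn:E; [lia|].
    replace (2 * S m - 1)%nat with (S (2 * m)) by lia.
    rewrite Nat.even_succ, <- Nat.negb_even, Nat.even_even; cbn [negb].
    replace (S (S (2 * m))) with (2 * S m)%nat by lia.
    rewrite Nat.div2_double, <- E, INR_IZR_INZ, Z2Nat.id by lia.
    rewrite opp_IZR; lra.
Qed.

(** [ratv] divides by the successor of its second argument, hence 2^h - 1. *)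
Lemma ratv_dyadic z h : ratv (zcode z) (2 ^ h - 1) = IZR z * (/ 2) ^ h.
Proof.
  unfold ratv, Rdiv; rewrite zint_zcode, half_pow; do 2 f_equal.
  assert (2 ^ h <> 0)%nat by (apply Nat.pow_nonzero; lia).
  replace (S (2 ^ h - 1)) with (2 ^ h)%nat by lia; rewrite pow_INR; auto.
Qed.

(** Entry n is the left end of the dyadic interval given by n bits: precise to 2^-n, and dependent
    on these bits only, as [lay_cont] demands. *)
Definition uname (b : cantor) : baire :=
  fun n => lcode [zcode (Z.of_nat (nval b n)); (2 ^ n - 1)%nat].

Definition dinterval (h : nat) (I : Z * Z) : R * R :=
  (IZR (fst I) * (/ 2) ^ h, IZR (snd I) * (/ 2) ^ h).

Definition dcode (h : nat) (I : Z * Z) : nat :=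
  lcode [zcode (fst I); (2 ^ h - 1)%nat; zcode (snd I); (2 ^ h - 1)%nat].

Lemma unit_delayed_name t h l A : (forall x, A x -> 0 <= x <= 1) ->
  (forall x, 0 <= x <= 1 ->
    (~ A x <-> exists I, In I l /\ fst (dinterval h I) < x < snd (dinterval h I))) ->
  unit_closed_name (delayed t (map (dcode h) l)) A.
Proof.
  intros HA H; split; auto; intros x Hx; rewrite (H x Hx); split.
  - intros [I [HI HIx]]; apply (in_map (dcode h)), (delayed_iff t) in HI as [i Hi].
    exists i, (zcode (fst I)), (2 ^ h - 1)%nat, (zcode (snd I)), (2 ^ h - 1)%nat.
    rewrite !ratv_dyadic; auto.
  - intros [i [z1 [d1 [z2 [d2 [Hi Hxi]]]]]].
    assert (HI : In (lcode [z1; d1; z2; d2]) (map (dcode h) l)).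
    { apply (delayed_iff t); exists i; exact Hi. }
    apply in_map_iff in HI as [I [E HI]]; apply lcode_inj in E; injection E as <- <- <- <-.
    rewrite !ratv_dyadic in Hxi; exists I; auto.
Qed.

Lemma subdivision_point X st N : 0 <= X -> X <= INR N * st -> (0 < N)%nat ->
  exists j, (j < N)%nat /\ INR j * st <= X <= (INR j + 1) * st.
Proof.
  intros H0 HX HN; induction N as [|N IH]; [lia|].
  destruct (Rle_dec X (INR N * st)) as [H|H].
  - destruct N as [|N]; [exists 0%nat; simpl in *; split; [lia|lra]|].
    destruct IH as [j [Hj Hj']]; auto; [lia|]; exists j; split; auto.
  - exists N; rewrite S_INR in HX; split; [lia|lra].
Qed.

(* The label of a point is the index [j] of the dyadic interval of length [2^-n]
   containing it. Labelled sets stay [2^-h] away from the end points, so that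
   the [h+1]-st approximation of a point determines its label. *)
Section UnitLabels.
Context (n d : nat) (s : list nat).
Let h := (n + d)%nat.
Let st := (2 ^ d)%nat.
Let N := (2 ^ n)%nat.

(** The unit of length is 2^-h, in which a cell has length [st]; one unit is cut off at both
    ends. *)
Definition core (x : R) := 0 <= x <= 1 /\ exists j, In j s /\
  INR j * INR st + 1 <= x * 2 ^ h <= (INR j + 1) * INR st - 1.

Definition around (j : nat) : Z * Z :=
  (Z.of_nat j * Z.of_nat st - 1, Z.of_nat j * Z.of_nat st + 1)%Z.
(** The extra unit on each side makes the open interval contain the closed cell, and reaches into
    neighbouring cells only within the margin that [core] omits. *)
Definition across (j : nat) : Z * Z :=
  (Z.of_nat j * Z.of_nat st - 1, (Z.of_nat j + 1) * Z.of_nat st + 1)%Z.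

Definition core_complement : list (Z * Z) :=
  map around (seq 0 (S N)) ++
  map across (filter (fun u => negb (labelled (fun j => j) s u)) (seq 0 N)).

Lemma in_dinterval I x :
  fst (dinterval h I) < x < snd (dinterval h I) <-> IZR (fst I) < x * 2 ^ h < IZR (snd I).
Proof.
  unfold dinterval; simpl; rewrite half_pow; pose proof (pow2_pos h) as Hp.
  assert (Hz : forall z, IZR z = IZR z * / 2 ^ h * 2 ^ h) by (intros; field; lra).
  rewrite (Hz (fst I)) at 2; rewrite (Hz (snd I)) at 2.
  split; intros [H1 H2]; split;
    solve [apply Rmult_lt_compat_r; auto | apply Rmult_lt_reg_r with (2 ^ h); auto].
Qed.

Lemma around_ends j : IZR (fst (around j)) = INR j * INR st - 1 /\
  IZR (snd (around j)) = INR j * INR st + 1.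
Proof.
  unfold around; cbn [fst snd]; rewrite minus_IZR, plus_IZR, mult_IZR, <- !INR_IZR_INZ; auto.
Qed.

Lemma across_ends j : IZR (fst (across j)) = INR j * INR st - 1 /\
  IZR (snd (across j)) = (INR j + 1) * INR st + 1.
Proof.
  unfold across; cbn [fst snd].
  rewrite minus_IZR, plus_IZR, !mult_IZR, plus_IZR, <- !INR_IZR_INZ; auto.
Qed.

Lemma core_complement_spec x : incl s (seq 0 N) -> 0 <= x <= 1 ->
  (~ core x <-> exists I, In I core_complement /\
     fst (dinterval h I) < x < snd (dinterval h I)).
Proof.
  intros Hs Hx.
  assert (Hst : 1 <= INR st).
  { unfold st; rewrite pow_INR; change (INR 2) with 2; apply pow_R1_Rle; lra. }
  assert (HD : 2 ^ h = INR N * INR st).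
  { unfold N, st, h; rewrite !pow_INR, pow_add; auto. }
  pose proof (pow2_pos h) as Hp.
  split.
  - intros Hc.
    destruct (subdivision_point (x * 2 ^ h) (INR st) N) as [j [Hj Hxj]]; [nra | nra | |].
    { unfold N; apply Nat.neq_0_lt_0, Nat.pow_nonzero; lia. }
    destruct (classic (In j s)) as [Hjs|Hjs].
    + destruct (Rlt_dec (x * 2 ^ h) (INR j * INR st + 1)) as [Hlo|Hlo].
      * exists (around j); split.
        { apply in_app_iff; left; apply in_map, in_seq; lia. }
        apply in_dinterval; destruct (around_ends j) as [-> ->]; lra.
      * exists (around (S j)); split.
        { apply in_app_iff; left; apply in_map, in_seq; lia. }
        apply in_dinterval; destruct (around_ends (S j)) as [-> ->]; rewrite S_INR.
        split; [|lra].
        apply Rnot_le_lt; intros Hhi; apply Hc; split; auto; exists j; split; auto; lra.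
    + exists (across j); split.
      { apply in_app_iff; right; apply in_map, filter_unlabelled; split; auto.
        apply in_seq; lia. }
      apply in_dinterval; destruct (across_ends j) as [-> ->]; lra.
  - intros [I [HI HIx]] [_ [j [Hj Hxj]]]; apply in_dinterval in HIx.
    assert (Hsep : forall i, (j < i)%nat -> (INR j + 1) * INR st <= INR i * INR st).
    { intros i Hi; apply Rmult_le_compat_r; [lra|]; rewrite <- S_INR; apply le_INR; auto. }
    assert (Hsep' : forall i, (i < j)%nat -> (INR i + 1) * INR st <= INR j * INR st).
    { intros i Hi; apply Rmult_le_compat_r; [lra|]; rewrite <- S_INR; apply le_INR; auto. }
    apply in_app_iff in HI as [HI|HI]; apply in_map_iff in HI as [i [<- Hi]].
    + destruct (around_ends i) as [E1 E2]; rewrite E1, E2 in HIx.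
      destruct (le_lt_dec i j) as [Hij|Hij].
      * assert (INR i * INR st <= INR j * INR st); [|lra].
        apply Rmult_le_compat_r; [lra|]; apply le_INR; auto.
      * specialize (Hsep i Hij); lra.
    + apply filter_unlabelled in Hi as [_ Hi].
      destruct (across_ends i) as [E1 E2]; rewrite E1, E2 in HIx.
      destruct (lt_eq_lt_dec i j) as [[Hij| ->]|Hij]; [| contradiction |].
      * specialize (Hsep' i Hij); lra.
      * specialize (Hsep i Hij); lra.
Qed.

(** The loss in units of 2^-h: [N + 1] intervals around cell ends have length 2 each, and at most
    [N] unwanted cells exceed their true length by 2 each, together 4 N + 2. *)
Lemma core_measure eps : NoDup s -> incl s (seq 0 N) ->
  (4 * INR N + 2) * (/ 2) ^ h < INR (length s) / 2 ^ n - eps ->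
  exists m, lebesgue_measure core m /\ eps < m.
Proof.
  intros Hnd Hs He.
  assert (Hp : 0 < (/ 2) ^ h) by (apply pow_lt; lra).
  assert (Hst : 1 <= INR st).
  { unfold st; rewrite pow_INR; change (INR 2) with 2; apply pow_R1_Rle; lra. }
  apply lebesgue_measure_gt with (l := map (dinterval h) core_complement).
  - intros x [Hx _]; auto.
  - intros I HI; apply in_map_iff in HI as [J [<- HJ]]; unfold dinterval; cbn [fst snd].
    apply Rmult_le_compat_r; [lra|].
    apply in_app_iff in HJ as [HJ|HJ]; apply in_map_iff in HJ as [i [<- _]].
    + destruct (around_ends i) as [-> ->]; lra.
    + destruct (across_ends i) as [-> ->]; lra.
  - intros x Hx Hcx; apply core_complement_spec in Hcx as [I [HI HIx]]; auto.
    exists (dinterval h I); split; auto; apply in_map; auto.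
  - unfold core_complement; rewrite map_app, rsum_app.
    rewrite (rsum_const _ (map _ (map around _)) (2 * (/ 2) ^ h)).
    2:{ intros I HI; rewrite map_map in HI; apply in_map_iff in HI as [i [<- _]].
        unfold ilen, dinterval; cbn [fst snd]; destruct (around_ends i) as [-> ->]; lra. }
    rewrite (rsum_const _ (map _ (map across _)) ((INR st + 2) * (/ 2) ^ h)).
    2:{ intros I HI; rewrite map_map in HI; apply in_map_iff in HI as [i [<- _]].
        unfold ilen, dinterval; cbn [fst snd]; destruct (across_ends i) as [-> ->]; lra. }
    rewrite !length_map, length_seq, S_INR.
    assert (Hlen := unlabelled_length (fun j => j) (seq 0 N) s Hnd ltac:(rewrite map_id; auto)).
    rewrite length_seq in Hlen; apply le_INR in Hlen; rewrite plus_INR in Hlen.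
    set (u := INR (length (filter _ (seq 0 N)))) in *.
    assert (Hu : 0 <= u) by apply pos_INR.
    assert (Hk : 0 <= INR (length s)) by apply pos_INR.
    assert (Ed : INR st * (/ 2) ^ h = / 2 ^ n).
    { unfold st, h; rewrite half_pow, pow_add, pow_INR; change (INR 2) with 2.
      field; split; apply Rgt_not_eq, pow2_pos. }
    assert (En : INR N * / 2 ^ n = 1).
    { unfold N; rewrite pow_INR; change (INR 2) with 2; apply Rinv_r, Rgt_not_eq, pow2_pos. }
    assert (Hn : 0 < / 2 ^ n) by (apply Rinv_0_lt_compat, pow2_pos).
    unfold Rdiv in He.
    assert (u * / 2 ^ n <= 1 - INR (length s) * / 2 ^ n) by nra.
    assert (u * (/ 2) ^ h <= INR N * (/ 2) ^ h) by nra.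
    replace (u * ((INR st + 2) * (/ 2) ^ h)) with (u * (INR st * (/ 2) ^ h) + 2 * (u * (/ 2) ^ h))
      by ring.
    rewrite Ed; lra.
Qed.

(** The witness is the left end of the shrunken cell [j], which is nonempty only if [st] is at least
    2; hence the condition on [d]. *)
Lemma core_inhabited j : In j s -> incl s (seq 0 N) -> (1 <= d)%nat -> exists x, core x.
Proof.
  intros Hj Hs Hd.
  assert (Hst : 2 <= INR st).
  { unfold st; change 2 with (INR 2); apply le_INR.
    change 2%nat with (2 ^ 1)%nat at 1; apply Nat.pow_le_mono_r; lia. }
  assert (HD : 2 ^ h = INR N * INR st).
  { unfold N, st, h; rewrite !pow_INR, pow_add; auto. }
  pose proof (pow2_pos h) as Hp.
  assert (HjN : INR j + 1 <= INR N).
  { rewrite <- S_INR; apply le_INR; apply Hs, in_seq in Hj; lia. }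
  pose proof (pos_INR j) as Hj0.
  exists ((INR j * INR st + 1) * / 2 ^ h).
  assert (E : (INR j * INR st + 1) * / 2 ^ h * 2 ^ h = INR j * INR st + 1) by (field; lra).
  split; [split|].
  - apply Rmult_le_reg_r with (2 ^ h); auto; rewrite E; nra.
  - apply Rmult_le_reg_r with (2 ^ h); auto; rewrite E, HD; nra.
  - exists j; split; auto; rewrite E; lra.
Qed.

End UnitLabels.

Definition in_cell (n : nat) (j : nat) (v : R) := INR j < v * 2 ^ n < INR j + 1.

Lemma in_cell_unique n i j v : in_cell n i v -> in_cell n j v -> i = j.
Proof.
  intros Hi Hj; unfold in_cell in *.
  assert (H1 : INR i < INR (S j)) by (rewrite S_INR; lra).
  assert (H2 : INR j < INR (S i)) by (rewrite S_INR; lra).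
  apply INR_lt in H1; apply INR_lt in H2; lia.
Qed.

Lemma unit_layout :
  layout unit_closed_name (rep Unit) lebesgue_measure beta uname.
Proof.
  split.
  - intros r A A' [H1 H2] [H1' H2']; apply complement_ext; intros x.
    destruct (classic (0 <= x <= 1)) as [Hx|Hx].
    + rewrite (H2 x Hx), (H2' x Hx); tauto.
    + split; intros _ HA; apply Hx; auto.
  - intros r A x [HA _] Hx; apply beta_onto; auto.
  - intros b; split; [apply beta_unit|]; intros n.
    exists (zcode (Z.of_nat (nval b n))), (2 ^ n - 1)%nat; split; auto.
    rewrite ratv_dyadic, <- INR_IZR_INZ; pose proof (beta_spec b n) as Hb.
    unfold dlow in Hb; apply Rabs_le; lra.
  - intros k b b' H i Hi; unfold uname; rewrite (nval_agree b b' i); auto.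
    apply agree_le with (2 := H); lia.
  - intros r A b [_ Hr] Hb; apply Hr in Hb as [n [z1 [d1 [z2 [d2 [Hn Hx]]]]]]; [|apply beta_unit].
    (* Within this distance of [beta b] a point stays inside the same excluded interval. *)
    destruct (half_pow_small (Rmin (beta b - ratv z1 d1) (ratv z2 d2 - beta b))) as [k Hk].
    { apply Rmin_glb_lt; lra. }
    exists (max (S n) k); intros r' A' b' Ha Hb' [_ Hr']; apply Hr'; [apply beta_unit|].
    exists n, z1, d1, z2, d2; split; [rewrite <- (Ha n); auto; lia|].
    assert (Hnear : Rabs (beta b - beta b') <= (/ 2) ^ k).
    { apply beta_near, agree_le with (2 := Hb'); lia. }
    pose proof (Rmin_l (beta b - ratv z1 d1) (ratv z2 d2 - beta b)).
    pose proof (Rmin_r (beta b - ratv z1 d1) (ratv z2 d2 - beta b)).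
    unfold Rabs in Hnear; destruct (Rcase_abs _); lra.
  - intros r A L W m [HA _]; apply lebesgue_measure_le; auto.
  - intros eps Heps; exists (fun x => 0 <= x <= 1), 0; split; [|split; [lra|]].
    + rewrite zeros_delayed; apply (unit_delayed_name 0 0 []); auto.
      intros x Hx; split; [tauto | intros [I [[] _]]].
    + apply lebesgue_measure_gt with (l := []); auto; [intros I [] | tauto | simpl; lra].
  - intros eps n k Hk Heps.
    assert (Hc : 0 < 4 * INR (2 ^ n) + 2) by (pose proof (pos_INR (2 ^ n)); lra).
    (* The margins have to cost less than the gap between [eps] and k / 2^n. *)
    destruct (half_pow_small ((INR k / 2 ^ n - eps) / (4 * INR (2 ^ n) + 2))) as [d0 Hd0].
    { apply Rdiv_lt_0_compat; lra. }
    (* The successor provides [1 <= d] for [core_inhabited]. *)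
    set (d := S d0); set (h := (n + d)%nat).
    assert (Hh : (4 * INR (2 ^ n) + 2) * (/ 2) ^ h < INR k / 2 ^ n - eps).
    { assert ((/ 2) ^ h <= (/ 2) ^ d0).
      { rewrite !half_pow; apply Rinv_le_contravar; [apply pow2_pos|].
        apply Rle_pow; [lra | unfold h, d; lia]. }
      apply Rmult_lt_reg_r with (/ (4 * INR (2 ^ n) + 2)); [apply Rinv_0_lt_compat; auto|].
      replace ((4 * INR (2 ^ n) + 2) * (/ 2) ^ h * / (4 * INR (2 ^ n) + 2)) with ((/ 2) ^ h)
        by (field; lra).
      unfold Rdiv in *; lra. }
    (* The label is read off the single entry [S h], which a prefix of length [S (S h)] contains. *)
    exists (fun r j => exists z e, r (S h) = lcode [z; e] /\ in_cell n j (ratv z e)), (S (S h)).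
    split; [|split].
    + intros r r' j H [z [e [E Hc']]]; exists z, e; split; auto; rewrite <- H; auto.
    + intros r i j [z [e [E Hi]]] [z' [e' [E' Hj]]].
      rewrite E in E'; apply lcode_inj in E'; injection E' as <- <-.
      eapply in_cell_unique; eauto.
    + intros s t HS1 HS2 HS3.
      assert (Hx : exists x, core n d s x).
      { destruct s as [|j s']; [simpl in HS3; lia|].
        apply core_inhabited with j; [left; auto | auto | unfold d; lia]. }
      destruct Hx as [x Hx].
      exists (delayed t (map (dcode h) (core_complement n d s))), (core n d s), x.
      split; [apply delayed_agree | split; [|split; [auto | split]]].
      * apply unit_delayed_name; [intros y [Hy _]; auto|].
        intros y Hy; apply core_complement_spec; auto.
      * apply core_measure; auto; rewrite HS3; auto.
      * intros r y [_ Hr] [_ [j [Hj Hy]]]; exists j; split; auto.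
        destruct (Hr (S h)) as [z [e [E Hz]]]; exists z, e; split; auto.
        fold h in Hy.
        assert (Hd : INR (2 ^ d) = 2 ^ d) by apply pow_INR.
        assert (E2 : 2 ^ h = 2 ^ n * 2 ^ d) by apply pow_add.
        pose proof (pow2_pos n) as Hpn; pose proof (pow2_pos d) as Hpd.
        pose proof (pow2_pos h) as Hph.
        (* The approximation errs by at most half a unit, less than the margin of one unit, so it
           lies strictly inside the cell of [y]. *)
        assert (Hz2 : Rabs (y - ratv z e) * 2 ^ h <= / 2).
        { apply Rmult_le_compat_r with (r := 2 ^ h) in Hz; [|lra].
          replace ((/ 2) ^ S h * 2 ^ h) with (/ 2) in Hz; auto.
          cbn [pow]; rewrite half_pow; field; lra. }
        assert (Hv : INR j * 2 ^ d < ratv z e * 2 ^ h < (INR j + 1) * 2 ^ d).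
        { rewrite Hd in Hy; unfold Rabs in Hz2; destruct (Rcase_abs _); nra. }
        rewrite E2, <- Rmult_assoc in Hv.
        split; apply Rmult_lt_reg_r with (2 ^ d); tauto.
Qed.

(** * The equivalences for both spaces *)

Lemma choice_equivalences {X : Type} {cname : baire -> (X -> Prop) -> Prop}
  {pname : baire -> X -> Prop} {meas : (X -> Prop) -> R -> Prop}
  {beta : cantor -> X} {nb : cantor -> baire} (Lay : layout cname pname meas beta nb)
  (eps delta : R) : 0 <= eps <= 1 -> 0 <= delta <= 1 ->
  let f := positive_choice cname pname meas in
  (weihrauch_le (f eps) (f delta) <-> strong_weihrauch_le (f eps) (f delta)) /\
  (strong_weihrauch_le (f eps) (f delta) <-> delta <= eps).
Proof.
  intros Heps Hdelta f.
  assert (Hle : delta <= eps ->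
            weihrauch_le (f eps) (f delta) /\ strong_weihrauch_le (f eps) (f delta)).
  { intros Hde; apply reducible_of_subset.
    - intros A x [[m [Hm Hlt]] HA]; split; auto; exists m; split; auto; lra.
    - intros A x [y [Hm _]] [_ HA]; split; auto. }
  assert (Hw : weihrauch_le (f eps) (f delta) -> delta <= eps).
  { intros [H [K [HH [HK Hred]]]].
    apply (separation Lay (H := fun p s => H (bpair p s)) (K := K)); auto; try lra.
    - apply continuous2_weak, computable_continuous; auto.
    - apply computable_continuous; auto. }
  assert (Hs : strong_weihrauch_le (f eps) (f delta) -> delta <= eps).
  { intros [H [K [HH [HK Hred]]]].
    apply (separation Lay (H := fun p s => H s) (K := K)); auto; try lra.
    - apply continuous2_strong, computable_continuous; auto.
    - apply computable_continuous; auto. }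
  tauto.
Qed.

Theorem theorem10p1 (eps delta : R) (Heps : 0 <= eps <= 1) (Hdelta : 0 <= delta <= 1) :
  ((weihrauch_le (PC_cantor eps) (PC_cantor delta) <->
      strong_weihrauch_le (PC_cantor eps) (PC_cantor delta)) /\
   (strong_weihrauch_le (PC_cantor eps) (PC_cantor delta) <-> delta <= eps)) /\
  ((weihrauch_le (PC_unit eps) (PC_unit delta) <->
      strong_weihrauch_le (PC_unit eps) (PC_unit delta)) /\
   (strong_weihrauch_le (PC_unit eps) (PC_unit delta) <-> delta <= eps)).
Proof.
  split.
  - exact (choice_equivalences cantor_layout eps delta Heps Hdelta).
  - exact (choice_equivalences unit_layout eps delta Heps Hdelta).
Qed.
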